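(* Algorithm 1 (given in full in the context) decides whether a graph with $n$ nodes is a basis exchange graph of a matroid, and if it is, then the algorithm returns a valid labelling of the graph in $O(n^3)$ steps.
   Context: A matroid is a nonempty collection $\mathcal{B}$ of subsets (bases) of a finite set $E$ such that for all $A,B\in\mathcal{B}$ and each $a\in A-B$ there is $b\in B-A$ with $A-a+b\in\mathcal{B}$ and $B+a-b\in\mathcal{B}$; here $\pm$ denotes inclusion or exclusion of elements. The basis exchange graph of a matroid with bases $\mathcal{B}$ has node set $\mathcal{B}$, and $A,B\in\mathcal{B}$ are adjacent if and only if $\#(A-B)=1$. An abstract graph is called a basis exchange graph of a matroid if it is isomorphic to such a graph. A valid labelling of a graph assigns to each node a set, so that the labels are the bases of a matroid and the labelling is an isomorphism onto the basis exchange graph of that matroid. The line graph of a graph $K$ has the edges of $K$ as nodes, two being adjacent if the edges share an endpoint; $K$ is called the original graph. $\mathrm{dist}$ is the distance in $G$. For two nodes at distance two, their common neighbour subgraph consists of these two nodes, all their common neighbours, and all edges of $G$ among these nodes. Square, square-based pyramid and octahedron refer to the vertex-edge graphs of these figures. Algorithm 1 (labelling a basis exchange graph). Input: a connected graph $G=(V,E)$ with at least two nodes (given as an adjacency matrix). Output: a valid labelling $\ell$ or False. 1. Pick $v\in V$. 2. $H\leftarrow\{w\in V : (v,w)\in E\}$. 3. If $(H,E\cap(H\times H))$ is not a line graph of a bipartite graph: 4. return False. 5. $(B_1\cup B_2,E_B)\leftarrow$ the original graph of the line graph $(H,E\cap(H\times H))$. It is bipartite with colour classes $B_1,B_2$ and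 has no isolated nodes; it is unique unless the line graph is a triangle, in which case one chooses the bipartite graph $K_{1,3}$ rather than $K_3$. 6. $\varphi:H\to E_B\leftarrow$ the corresponding bijection. 7. Set $\ell(v)=B_1$. 8. For $w\in H$ do lines 9-10: 9. $(e,f)\leftarrow\varphi(w)$. 10. Set $\ell(w)=B_1-e+f$. 11. For $j=2,\ldots,\#B_1$ do lines 12-21: 12. $L\leftarrow\{u\in V : \mathrm{dist}(u,v)=j\}$. 13. While $L$ is not empty do lines 14-21: 14. Pick $u\in L$ and remove $u$ from $L$. 15. Pick $\hat v\in\{x\in V : \mathrm{dist}(x,v)=j-2 \text{ and } \mathrm{dist}(x,u)=2\}$. 16. $T\leftarrow\{w\in V : \mathrm{dist}(w,u)=\mathrm{dist}(w,\hat v)=1\}$. 17. $W\leftarrow\{(x_1,x_2)\in T\times T : x_1\neq x_2 \text{ and } (x_1,x_2)\notin E\}$. 18. If $W$ is empty: 19. return False. 20. Pick $(w_1,w_2)\in W$. 21. Set $\ell(u)=(\ell(w_1)\cap\ell(w_2))\cup(\ell(w_1)\cup\ell(w_2)-\ell(\hat v))$. 22. For $u,w\in V$ do lines 23-24: 23. If $\#(\ell(u)-\ell(v))\neq\mathrm{dist}(u,v)$, or $\mathrm{dist}(u,w)=2$ and the common neighbour subgraph (of $u$ and $w$) is neither a square, square-based pyramid or octahedron: 24. return False. 25. Return $\ell$.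
   Formalization: Line 23 of Algorithm 1 is corrected: the test is #(ℓ(u)-ℓ(w)) ≠ dist(u,w) for all u,w in V, instead of #(ℓ(u)-ℓ(v)) ≠ dist(u,v). As printed, the algorithm wrongly accepts the folded 5-cube, which is not a basis exchange graph. *)

(* Defs.v *)
(* MathComp *)
From mathcomp Require Import all_boot.

Set Implicit Arguments.
Unset Strict Implicit.
Unset Printing Implicit Defensive.

(** * Matroids, basis exchange graphs, valid labellings *)

Definition is_matroid (E : finType) (Bs : {set {set E}}) : Prop :=
  Bs != set0 /\
  forall A B, A \in Bs -> B \in Bs -> forall a, a \in A :\: B ->
    exists b, [/\ b \in B :\: A, b |: (A :\ a) \in Bs & a |: (B :\ b) \in Bs].

Definition exchange_adj (E : finType) (A B : {set E}) : bool :=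
  #|A :\: B| == 1.

(* [l] is an isomorphism from the graph [e] onto the basis exchange graph of
   the matroid with bases [Bs]. *)
Definition exchange_iso (n : nat) (e : rel 'I_n) (E : finType)
    (l : 'I_n -> {set E}) (Bs : {set {set E}}) : Prop :=
  [/\ injective l, [set l u | u : 'I_n] = Bs
    & forall u w, e u w = exchange_adj (l u) (l w)].

Definition basis_exchange_graph (n : nat) (e : rel 'I_n) : Prop :=
  exists (E : finType) (Bs : {set {set E}}) (l : 'I_n -> {set E}),
    is_matroid Bs /\ exchange_iso e l Bs.

Definition valid_labelling (n : nat) (e : rel 'I_n) (E : finType)
    (l : 'I_n -> {set E}) : Prop :=
  exists Bs : {set {set E}}, is_matroid Bs /\ exchange_iso e l Bs.

(** * Line graphs of bipartite graphs *)

(* A bipartite graph with colour classes inside [X] and [Y] is given by its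
   edge set [K : {set X * Y}]; isolated nodes are not represented.  *)
Definition line_adj (X Y : finType) (p q : X * Y) : bool :=
  (p != q) && ((p.1 == q.1) || (p.2 == q.2)).

(* [phi] is an isomorphism from the subgraph of [e] induced by [H] onto the
   line graph of [K]. *)
Definition line_iso (n : nat) (e : rel 'I_n) (H : seq 'I_n) (X Y : finType)
    (K : {set X * Y}) (phi : 'I_n -> X * Y) : Prop :=
  [/\ {in H &, injective phi}, [set phi w | w in H] = K
    & {in H &, forall u w, e u w = line_adj (phi u) (phi w)}].

Definition line_graph_of_bipartite (n : nat) (e : rel 'I_n) (H : seq 'I_n)
    : Prop :=
  exists (X Y : finType) (K : {set X * Y}) (phi : 'I_n -> X * Y),
    line_iso e H K phi.

(** * Programs with unit-cost steps and arbitrary picks *)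

(* [Reject] stops the whole program with answer False.  Each [Step] pays for a
   number of elementary operations (array accesses, comparisons and arithmetic
   on numbers of size O(n), appending to a list) that is bounded by a constant
   read off the program text.  Accordingly, in the programs below every loop
   pays at least one [Step] per iteration ([foldP], [drain]), every traversal
   of a list and every construction of an array or bit vector pays one [Step]
   per entry ([pass]), and every pick pays one [Step]; what is left between two
   [Step]s is straight-line code.  Arrays are represented by functions, and
   bit vectors by finite sets. *)
Inductive prog (A : Type) : Type :=
| Ret of A
| Reject
| Step of prog A
| Any (T : eqType) (s : seq T) of (T -> prog A).

Arguments Reject {A}.
Arguments Any {A T} s _.

Fixpoint bind (A B : Type) (p : prog A) (k : A -> prog B) : prog B :=
  match p with
  | Ret a => k a
  | Reject => Reject
  | Step p' => Step (bind p' k)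
  | Any _ s f => Any s (fun i => bind (f i) k)
  end.

Notation "'let*' x ':=' p 'in' q" := (bind p (fun x => q))
  (at level 200, x name, p at level 100, q at level 200,
   format "'[v' 'let*'  x  ':='  p  'in' '/' q ']'").

(* Whatever is picked, the program never picks from an empty list, and it ends
   with a result [out] ([None] for False) after [t] steps such that
   [Q out t]. *)
Fixpoint every_run (A : Type) (p : prog A) (Q : option A -> nat -> Prop)
    : Prop :=
  match p with
  | Ret a => Q (Some a) 0
  | Reject => Q None 0
  | Step p' => every_run p' (fun out t => Q out t.+1)
  | Any _ s f => s != [::] /\ forall i, i \in s -> every_run (f i) Q
  end.

Definition pick_in (I : eqType) (s : seq I) : prog I :=
  Step (Any s (@Ret I)).

(* [a] is computed by a single pass over [s]. *)
Definition pass (I A : Type) (s : seq I) (a : A) : prog A :=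
  iter (size s) (@Step A) (Ret a).

Definition select (I : Type) (p : pred I) (s : seq I) : prog (seq I) :=
  pass s (filter p s).

Fixpoint foldP (I A : Type) (s : seq I) (acc : A) (body : I -> A -> prog A)
    : prog A :=
  if s is i :: s' then
    Step (let* acc' := body i acc in foldP s' acc' body)
  else Ret acc.

(* "While [L] is not empty: pick [u] in [L], remove [u] from [L], ...";
   to be called with [k = size L]. *)
Fixpoint drain (I : eqType) (A : Type) (k : nat) (L : seq I) (acc : A)
    (body : I -> A -> prog A) : prog A :=
  if k is k'.+1 then
    let* u := pick_in L in
    let* L' := pass L (rem u L) in
    let* acc' := body u acc in
    drain k' L' acc' body
  else Ret acc.

Definition set_at (T : eqType) (A : Type) (f : T -> A) (x : T) (a : A)
    : T -> A :=
  fun y => if y == x then a else f y.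

(** * The labelling algorithm *)

Section Algorithm.

Variables (n : nat) (e : rel 'I_n).

Let V : seq 'I_n := enum 'I_n.
Let VV : seq ('I_n * 'I_n) := [seq (x, y) | x <- V, y <- V].

(* The distances in [e], by the Floyd-Warshall recurrence; [n] stands for
   infinity. *)
Definition distances : prog ('I_n -> 'I_n -> nat) :=
  let* d0 := pass VV (fun i j => if i == j then 0 else if e i j then 1 else n)
  in foldP V d0 (fun k d =>
       pass VV (fun i j => minn (d i j) (d i k + d k j))).

(* A set of pairwise distinct nodes [H] is turned into a bipartite graph by
   giving the nodes [x] of [H] their edges [phi x] one at a time, preferably
   next to a node that already has its edge.  The edge of [x] then has to share
   the first or the second endpoint of the edge of a neighbour of [x] in [D];
   its other endpoint is forced by the remaining neighbours, and is a new one,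
   called [x], if there are none. *)
Definition original_graph (H : seq 'I_n) : prog ('I_n -> 'I_n * 'I_n) :=
  let* phi0 := pass V (fun x => (x, x)) in
  let* D0 := pass V set0 in
  let* res := foldP H (D0, phi0) (fun _ Dphi =>
    let: (D, phi) := Dphi in
    let* rest := select (fun x => x \notin D) H in
    let* front := pass [seq (x, y) | x <- H, y <- H]
      [seq x <- rest | has (fun y => (y \in D) && e x y) H] in
    let* x := pick_in (if front is [::] then rest else front) in
    let* P := select (fun y => (y \in D) && e x y) H in
    if P is y :: _ then
      let: (r, c) := phi y in
      let* Pr := select (fun z => (phi z).1 != r) P in
      let* Pc := select (fun z => (phi z).2 != c) P in
      let p1 := (r, if Pr is z :: _ then (phi z).2 else x) in
      let p2 := (if Pc is z :: _ then (phi z).1 else x, c) in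
      let fits p := all (fun z => (z \in D) ==>
        (phi z != p) && (e x z == line_adj (phi z) p)) H
      in
      let* fits1 := pass H (fits p1) in
      let* fits2 := pass H (fits p2) in
      let cands := (if fits1 then [:: p1] else [::])
                   ++ (if fits2 then [:: p2] else [::]) in
      if cands is [::] then Reject else
      let* p := pick_in cands in
      Ret (x |: D, set_at phi x p)
    else Ret (x |: D, set_at phi x (x, x)))
  in Ret res.2.

(* Ground set of the labels: [inl] for the nodes of B1, [inr] for those of B2. *)
Definition elt : finType := ('I_n + 'I_n)%type.

Let elts : seq elt := enum {: elt}.

(* The subgraph of [e] induced by the nodes [s] is isomorphic to the graph
   [fig] on 0, ..., m-1. *)
Definition has_figure (m : nat) (fig : rel nat) (x0 : 'I_n) (s : seq 'I_n)
    : bool :=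
  (size s == m) &&
  has (fun t => all (fun i => all (fun j =>
         e (nth x0 t i) (nth x0 t j) == fig i j) (iota 0 m)) (iota 0 m))
      (permutations s).

Definition square : rel nat := fun i j => odd (i + j).

(* Node 4 is the apex. *)
Definition pyramid : rel nat :=
  fun i j => (i != j) && [|| i == 4, j == 4 | odd (i + j)].

(* The opposite pairs are 03, 14 and 25. *)
Definition octahedron : rel nat := fun i j => i %% 3 != j %% 3.

Definition good_neighbour_subgraph (u w : 'I_n) (common : seq 'I_n) : bool :=
  let s := [:: u, w & common] in
  [|| has_figure 4 square u s, has_figure 5 pyramid u s
    | has_figure 6 octahedron u s].

(* [root] recognizes whether the neighbourhood [H] of [v] is the line graph of
   a bipartite graph and returns the bijection [phi] from [H] to the edges of
   the original graph.  Nodes start with an empty label, and keep it if their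
   distance to [v] exceeds [#|B1|].  The final loop compares the label of [u]
   with the labels of all nodes [w]; comparing it only with the label of [v]
   would let the folded 5-cube pass, which is not a basis exchange graph. *)
Definition algorithm1 (root : seq 'I_n -> prog ('I_n -> 'I_n * 'I_n))
    : prog ('I_n -> {set elt}) :=
  let* d := distances in
  let* v := pick_in V in
  let* H := select (e v) V in
  let* phi := root H in
  let* B0 := pass elts set0 in
  let* B1 := foldP H B0 (fun w B => Ret (inl (phi w).1 |: B)) in
  let* l0 := pass [seq (u, x) | u <- V, x <- elts] (fun _ => set0) in
  let* lv := pass elts B1 in
  let* l1 := foldP H (set_at l0 v lv) (fun w l =>
    let* lw := pass elts (inr (phi w).2 |: (B1 :\ inl (phi w).1)) in
    Ret (set_at l w lw)) in
  let* m := pass elts #|B1| in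
  let* l2 := foldP (iota 2 m.-1) l1 (fun j l =>
    let* L := select (fun u => d u v == j) V in
    drain (size L) L l (fun u l =>
      let* cand := select (fun x => (d x v == j - 2) && (d x u == 2)) V in
      let* v' := pick_in cand in
      let* T := select (fun w => (d w u == 1) && (d w v' == 1)) V in
      let TT := [seq (x1, x2) | x1 <- T, x2 <- T] in
      let* W := select (fun p => (p.1 != p.2) && ~~ e p.1 p.2) TT in
      if W is [::] then Reject else
      let* w := pick_in W in
      let* lu := pass elts ((l w.1 :&: l w.2)
                              :|: ((l w.1 :|: l w.2) :\: l v')) in
      Ret (set_at l u lu))) in
  let* _ := foldP VV tt (fun uw _ =>
    let: (u, w) := uw in
    let* k := pass elts #|l2 u :\: l2 w| in
    if k != d u w then Reject else
    if d u w == 2 then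
      let* common := select (fun x => e x u && e x w) V in
      if good_neighbour_subgraph u w common then Ret tt else Reject
    else Ret tt) in
  Ret l2.

End Algorithm.

(* [root] takes O(n^3) steps, and whatever it picks, it returns False if
   the subgraph induced by [H] is not the line graph of a bipartite graph, and
   otherwise the edges [phi w] of an original bipartite graph. *)
Definition root_routine
    (root : forall n, rel 'I_n -> seq 'I_n -> prog ('I_n -> 'I_n * 'I_n))
    : Prop :=
  exists C : nat, forall (n : nat) (e : rel 'I_n) (H : seq 'I_n),
    1 < n -> symmetric e -> irreflexive e -> uniq H ->
    every_run (root n e H) (fun out t =>
      t <= C * n ^ 3 /\
      match out with
      | None => ~ line_graph_of_bipartite e H
      | Some phi => exists K : {set 'I_n * 'I_n}, line_iso e H K phi
      end).

(* Main.v *)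
Require Import Defs.
From mathcomp Require Import all_boot zify.

(** Write [d] for the distance and [l] for a labelling of the nodes.

    Why an accepted labelling is valid. The final loop leaves only labellings
    with [#|l u :\: l w| = d u w] in which two nodes at distance two have two
    common neighbours that are not adjacent. For labels [A] and [B] at distance
    two, such a pair of neighbours is a symmetric exchange between [A] and [B]
    for each element of [A :\: B] ([square_exchange]). In a family of sets in
    which one can always move along a geodesic, symmetric exchange at distance
    two propagates to all distances by induction on [#|A :\: B|]
    ([local_exchange]). So the labels are the bases of a matroid.

    Why a basis exchange graph is accepted. Let [l] be a valid labelling. A
    neighbour [w] of [v] has a label [l v - a + b]; reading it as an edge [ab]
    turns the neighbourhood of [v] into the line graph of a bipartite graph, so
    the root routine succeeds. It may find another bipartite graph, but two
    bipartite graphs with the same line graph differ only in that the colour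
    classes of some components are swapped ([line_rep_unique]). Swapping a
    component amounts to dualizing a direct summand of the matroid: each basis
    is complemented inside the component. All bases have the same number of
    elements there ([card_exchange_closed]), so the distances do not change.
    Hence some isometric labelling extends the labels that the algorithm gives
    to [v] and its neighbours ([line_rep_labelling]). In an isometric labelling
    the label of [u] is determined by the labels of a node at distance two and
    of two nonadjacent common neighbours ([square_labels]), so the algorithm
    can only reproduce that labelling, and all checks succeed.

    Why the bipartite graph of a line graph is found greedily. What has been
    built on the set [D] of processed nodes agrees with every bipartite graph of
    the whole line graph up to swaps of components. As nodes next to [D] are
    processed first, the neighbours in [D] of the next node lie in a single
    component of [D]; so the two graphs agree near this node up to one common
    swap, and one of the two candidate edges fits
    ([original_graph_candidates]).

    Running time. Apart from the root routine, everything outside the loop over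
    the distance levels is a nesting of at most three loops of length O(n).
    Labelling one node costs O(n^2), and the levels are disjoint, so that they
    contribute O(n^3) in total ([sum_size_levels]). *)

Set Implicit Arguments.
Unset Strict Implicit.
Unset Printing Implicit Defensive.

(** * Running programs *)

(** A Hoare triple for total correctness with a time bound; [R] is what a
    rejection proves. *)
Definition spec (A : Type) (c : nat) (R : Prop) (Post : A -> Prop)
    (p : prog A) : Prop :=
  every_run p (fun out t => t <= c /\ if out is Some a then Post a else R).

Lemma every_run_mono (A : Type) (p : prog A) (Q Q' : option A -> nat -> Prop) :
  (forall out t, Q out t -> Q' out t) -> every_run p Q -> every_run p Q'.
Proof.
elim: p Q Q' => [a||p IHp|T s f IHf] Q Q' QQ' /=; try exact: QQ'.
  by apply: IHp => out t; apply: QQ'.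
by case=> sN0 run_f; split=> // i /run_f; apply: IHf.
Qed.

Lemma every_run_bind (A B : Type) (p : prog A) (k : A -> prog B)
    (Q : option B -> nat -> Prop) :
  every_run p (fun out t => if out is Some a
    then every_run (k a) (fun out' t' => Q out' (t + t')) else Q None t) ->
  every_run (bind p k) Q.
Proof.
elim: p Q => [a||p IHp|T s f IHf] Q //=.
  by move=> run_p; apply: IHp.
by case=> sN0 run_f; split=> // i /run_f; apply: IHf.
Qed.

Section Triples.

Variables (A B : Type) (R : Prop).

Lemma spec_weaken c c' (R' : Prop) (P P' : A -> Prop) (p : prog A) :
    spec c R' P p -> c <= c' -> (R' -> R) -> (forall a, P a -> P' a) ->
  spec c' R P' p.
Proof.
move=> sp cc' RR' PP'; apply: every_run_mono sp => -[a|] t [tc] h.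
  by split; [apply: leq_trans cc' | apply: PP'].
by split; [apply: leq_trans cc' | apply: RR'].
Qed.

Lemma spec_le c c' (P : A -> Prop) (p : prog A) :
  c <= c' -> spec c R P p -> spec c' R P p.
Proof. by move=> cc' sp; apply: spec_weaken sp cc' _ _. Qed.

Lemma spec_ret c (P : A -> Prop) a : P a -> spec c R P (Ret a).
Proof. by []. Qed.

Lemma spec_reject c (P : A -> Prop) : R -> spec c R P Reject.
Proof. by []. Qed.

Lemma spec_step c (P : A -> Prop) p : spec c R P p -> spec c.+1 R P (Step p).
Proof. exact: every_run_mono. Qed.

Lemma spec_bind c1 c2 (M : A -> Prop) (P : B -> Prop) p (k : A -> prog B) :
    spec c1 R M p -> (forall a, M a -> spec c2 R P (k a)) ->
  spec (c1 + c2) R P (bind p k).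
Proof.
move=> sp sk; apply: every_run_bind; apply: every_run_mono sp.
move=> [a|] t [tc h]; last by split=> //; apply: leq_trans (leq_addr _ _).
apply: every_run_mono (sk a h) => out t' [t'c h']; split=> //.
exact: leq_add.
Qed.

Lemma spec_pass (I : Type) c (P : A -> Prop) (s : seq I) a :
  size s <= c -> P a -> spec c R P (pass s a).
Proof.
rewrite /pass; elim: s c => [|i s IHs] [|c] //= sc Pa.
by apply: spec_step; apply: IHs.
Qed.

End Triples.

Lemma spec_bind_pass (A B I : Type) (R : Prop) c1 c2 (P : B -> Prop) (s : seq I)
    (a : A) (k : A -> prog B) :
    size s <= c1 -> spec c2 R P (k a) -> spec (c1 + c2) R P (bind (pass s a) k).
Proof.
by move=> sc sk; apply: (spec_bind (M := eq a)) => [|_ <- //]; apply: spec_pass.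
Qed.

Lemma spec_bind_pick (T : eqType) (B : Type) (R : Prop) c (P : B -> Prop)
    (s : seq T) (k : T -> prog B) :
    s != [::] -> (forall i, i \in s -> spec c R P (k i)) ->
  spec (1 + c) R P (bind (pick_in s) k).
Proof.
by move=> sN0 sk; apply: (spec_bind (c1 := 1) (M := fun i => i \in s)).
Qed.

(** The invariant speaks of the processed prefix, and the cost may depend on the
    index; the latter is what amortizes the loop over the distance levels. *)
Lemma spec_foldP (I A : Type) (R : Prop) (c : I -> nat) (s : seq I) (acc : A)
    (body : I -> A -> prog A) (Inv : seq I -> A -> Prop) :
    Inv [::] acc ->
    (forall pre i post a, s = pre ++ i :: post -> Inv pre a ->
       spec (c i) R (Inv (rcons pre i)) (body i a)) ->
  spec (\sum_(i <- s) (c i).+1) R (Inv s) (foldP s acc body).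
Proof.
move=> Inv0 Inv_body.
suff H s1 s2 a : s1 ++ s2 = s -> Inv s1 a ->
    spec (\sum_(i <- s2) (c i).+1) R (Inv s) (foldP s2 a body).
  exact: H Inv0.
elim: s2 s1 a => [|i s2 IHs] s1 a /= Es Inv_a.
  by rewrite cats0 in Es; subst s1; apply: spec_ret.
rewrite big_cons addSn; apply: spec_step.
apply: (spec_bind (Inv_body s1 i s2 a _ Inv_a)) => // a' Inv_a'.
by apply: IHs Inv_a'; rewrite cat_rcons.
Qed.

Lemma spec_bind_foldP (I A B : Type) (R : Prop) (Inv : seq I -> A -> Prop)
    b c c2 (P : B -> Prop) (s : seq I) acc (body : I -> A -> prog A)
    (k : A -> prog B) :
    size s <= b -> Inv [::] acc ->
    (forall pre i post a, s = pre ++ i :: post -> Inv pre a ->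
       spec c R (Inv (rcons pre i)) (body i a)) ->
    (forall a, Inv s a -> spec c2 R P (k a)) ->
  spec (b * c.+1 + c2) R P (bind (foldP s acc body) k).
Proof.
move=> sb Inv0 Inv_body Inv_k; apply: spec_bind Inv_k.
apply: (spec_le (c := \sum_(i <- s) c.+1)); last exact: spec_foldP.
by rewrite big_const_seq count_predT iter_addn_0 mulnC leq_mul2r sb orbT.
Qed.

(** Here the invariant speaks of the remaining list, as the order of the picks
    is arbitrary. *)
Lemma spec_drain (I : eqType) (A : Type) (R : Prop) (c b : nat)
    (L0 : seq I) (acc : A) (body : I -> A -> prog A)
    (Inv : seq I -> A -> Prop) :
    size L0 <= b -> Inv L0 acc ->
    (forall L u a, u \in L -> {subset L <= L0} -> Inv L a ->
       spec c R (Inv (rem u L)) (body u a)) ->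
  spec (size L0 * (1 + (b + c))) R (Inv [::]) (drain (size L0) L0 acc body).
Proof.
move=> L0b Inv0 Inv_body.
suff H k L a : size L = k -> k <= b -> {subset L <= L0} -> Inv L a ->
    spec (k * (1 + (b + c))) R (Inv [::]) (drain k L a body).
  exact: H.
elim: k L a => [|k IHk] L a /= sL kb sub_L Inv_a.
  by move/size0nil: sL Inv_a => ->; apply: spec_ret.
rewrite mulSn -addnA; apply: spec_bind_pick => [|u uL]; first by case: (L) sL.
have sr: size (rem u L) = k by rewrite size_rem // sL.
rewrite -addnA; apply: spec_bind_pass; first by rewrite sL.
apply: (spec_bind (Inv_body _ _ _ uL sub_L Inv_a)) => a' Inv_a'.
apply: IHk => //; first exact: ltnW.
by move=> x /mem_rem /sub_L.
Qed.

(** * Distances in a connected graph *)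

Section Metric.

Variables (T : finType) (e : rel T).

(** Three local properties that pin down the distance of a connected graph
    ([graph_metric_uniq]); both the output of the program [distances] and the
    function [#|l u :\: l w|] of a matroid are recognized by them. *)
Definition graph_metric (d : T -> T -> nat) : Prop :=
  [/\ forall u, d u u = 0, forall x y w, e x y -> d x w <= (d y w).+1
    & forall u w, u != w -> exists2 x, e u x & d u w = (d x w).+1].

Lemma graph_metric_uniq d d' :
  graph_metric d -> graph_metric d' -> forall u w, d u w = d' u w.
Proof.
suff H d1 d2 : graph_metric d1 -> graph_metric d2 ->
    forall u w, d1 u w <= d2 u w.
  by move=> md md' u w; apply/eqP; rewrite eqn_leq !H.
move=> [d10 d1S _] [_ _ d2P] u w.
have [k le_k] : exists k, d2 u w <= k by exists (d2 u w).
elim: k u le_k => [|k IHk] u.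
  case: (altP (u =P w)) => [->|/d2P[x _ ->] //]; by rewrite d10.
case: (altP (u =P w)) => [->|/d2P[x ux ->] le_k]; first by rewrite d10.
by apply: leq_trans (d1S _ _ _ ux) _; rewrite ltnS IHk.
Qed.

Hypotheses (sym_e : symmetric e) (irr_e : irreflexive e).
Variable d : T -> T -> nat.
Hypothesis md : graph_metric d.

Lemma metric0 u w : (d u w == 0) = (u == w).
Proof.
case: md => d0 _ dP; case: (altP (u =P w)) => [->|/dP[x _ -> //]].
by rewrite d0.
Qed.

Lemma metric_triangle u x w : d u w <= d u x + d x w.
Proof.
case: md => d0 dS dP.
have [k duxE] : exists k, d u x == k by exists (d u x).
elim: k u duxE => [|k IHk] u.
  by rewrite metric0 => /eqP->; rewrite leq_addl.
case: (altP (u =P x)) => [->|/dP[y uy ->]]; first by rewrite d0.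
rewrite eqSS addSn => /IHk; rewrite -ltnS; exact: leq_trans (dS _ _ _ uy).
Qed.

Lemma metric_edge u w : e u w = (d u w == 1).
Proof.
case: md => d0 dS dP; apply/idP/idP => [uw|/eqP duw].
  rewrite eqn_leq lt0n metric0 (leq_trans (dS _ _ w uw)) ?d0 //=.
  by apply/eqP=> uwE; rewrite uwE irr_e in uw.
have /dP[x ux] : u != w by rewrite -metric0 duw.
by rewrite duw => -[] /esym/eqP; rewrite metric0 => /eqP<-.
Qed.

Lemma metric_sym u w : d u w = d w u.
Proof.
suff H x y : d x y <= d y x by apply/eqP; rewrite eqn_leq !H.
case: md => d0 dS dP.
have [k dyxE] : exists k, d y x == k by exists (d y x).
elim: k y dyxE => [|k IHk] y; first by rewrite metric0 => /eqP->; rewrite d0.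
case: (altP (y =P x)) => [->|/dP[z yz ->]]; first by rewrite d0.
rewrite eqSS => /IHk le_k; apply: leq_trans (metric_triangle x z y) _.
rewrite -addn1 leq_add //; move: yz; rewrite sym_e metric_edge => /eqP-> //.
Qed.

Lemma metric2 u w x : u != w -> ~~ e u w -> e x u -> e x w -> d u w = 2.
Proof.
rewrite -metric0 !metric_edge => u0 u1 /eqP xu /eqP xw.
have := metric_triangle u x w; rewrite (metric_sym u x) xu xw.
by case: (d u w) u0 u1 => [|[|[|?]]].
Qed.

Lemma metric_back2 u v j : d u v = j -> 1 < j ->
  exists2 x, d x v = j - 2 & d x u = 2.
Proof.
case: (md) => d0 dS dP duv j1.
have /dP[x ux dx] : u != v by rewrite -metric0 duv; case: j j1 {duv}.
have /dP[y xy dy] : x != v by rewrite -metric0; lia.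
exists y; first lia.
have := metric_triangle y x u; have := metric_triangle u y v.
move: ux xy; rewrite !metric_edge => /eqP ux /eqP xy.
rewrite !(metric_sym y u) (metric_sym y x) (metric_sym x u) ux xy; lia.
Qed.

End Metric.

Section FloydWarshall.

Variables (n : nat) (e : rel 'I_n).

(** The value [n] stands for infinity, so only smaller values have to come from a
    walk. *)
Definition walk_bound (d : 'I_n -> 'I_n -> nat) : Prop :=
  forall i j, d i j < n ->
    exists2 p, path e i p & last i p = j /\ size p = d i j.

(** The invariant of Floyd and Warshall, for paths with all interior nodes in
    [S]. Simple paths suffice, and a simple path visits the next pivot at most
    once, which lets it be cut there. *)
Definition short_via (S : seq 'I_n) (d : 'I_n -> 'I_n -> nat) : Prop :=
  forall i p, path e i p -> uniq (i :: p) ->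
    {in p, forall x, x != last i p -> x \in S} -> d i (last i p) <= size p.

Lemma short_via_step S k d :
  short_via S d ->
  short_via (rcons S k) (fun i j => minn (d i j) (d i k + d k j)).
Proof.
move=> short_d i p ip uip pS; rewrite geq_min; set j := last i p in pS *.
have [/andP[kp kj]|k_out] := boolP ((k \in p) && (k != j)); last first.
  rewrite short_d // => x xp xj; have := pS x xp xj.
  rewrite mem_rcons inE => /orP[/eqP xk|//].
  by move: k_out; rewrite -xk xp xj.
apply/orP; right; subst j.
case/path.splitP: kp ip uip pS kj => p1 p2.
rewrite cat_path last_rcons size_cat last_cat last_rcons -cat_cons.
rewrite cat_uniq /= rcons_uniq.
move=> /andP[ip1 kp2] /andP[/andP[ip1N /andP[kp1 up1]] /andP[no up2]] pS kj.
have last_p2 : last k p2 \in p2.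
  by case: (p2) kj => [|x p3] /=; rewrite ?eqxx // mem_last.
have kp2N : k \notin p2.
  by apply: contra no => kp2'; apply/hasP; exists k;
    rewrite // inE mem_rcons mem_head orbT.
apply: leq_add.
  rewrite -[k in d i k](last_rcons i p1 k) short_d //=.
    by rewrite ip1N rcons_uniq kp1.
  move=> x xp1; rewrite last_rcons => xk.
  have := pS x; rewrite mem_cat xp1 !mem_rcons inE (negPf xk) /=; apply=> //.
  apply: contra no => /eqP xl; apply/hasP; exists x; first by rewrite xl.
  by rewrite inE xp1 orbT.
rewrite short_d //= ?kp2N // => x xp2 xl.
have := pS x; rewrite mem_cat xp2 orbT mem_rcons inE => /(_ isT xl).
by case/orP=> // /eqP xk; rewrite -xk xp2 in kp2N.
Qed.

Lemma walk_metric d :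
    (forall u v, connect e u v) -> walk_bound d -> short_via (enum 'I_n) d ->
  graph_metric e d.
Proof.
move=> conn_e walk_d short_d.
have le_walk i p : path e i p -> d i (last i p) <= size p.
  move=> ip; have [p' ip' up' sub_p'] := shortenP ip.
  apply: leq_trans (short_d i p' ip' up' _) _.
    by move=> x; rewrite mem_enum.
  by apply: uniq_leq_size => //; case/andP: up'.
have d_walk i j : exists2 p, path e i p & last i p = j /\ size p = d i j.
  apply: walk_d; have /connectP[p ip ->] := conn_e i j.
  have [p' ip' up' _] := shortenP ip.
  apply: leq_ltn_trans (le_walk _ _ ip') _.
  by have := max_card (mem (i :: p')); rewrite (card_uniqP up') card_ord.
have dS x y w : e x y -> d x w <= (d y w).+1.
  move=> xy; have [p yp [lp <-]] := d_walk y w.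
  by have := le_walk x (y :: p); rewrite /= lp xy yp; apply.
split=> // [u|u w uw].
  by have := le_walk u [::] isT; rewrite leqn0 => /eqP.
have [[|x p] /= up [lp sp]] := d_walk u w; first by rewrite lp eqxx in uw.
case/andP: up => ux xp; exists x => //; apply/eqP; rewrite eqn_leq dS //=.
by rewrite -sp ltnS -lp le_walk.
Qed.

Lemma distances_spec R :
    (forall u v, connect e u v) ->
  spec (n * n + n * (n * n).+1) R (graph_metric e) (distances e).
Proof.
move=> conn_e; rewrite /distances.
have sVV : size [seq (x, y) | x <- enum 'I_n, y <- enum 'I_n] = n * n.
  by rewrite size_allpairs size_enum_ord.
apply: spec_bind_pass; first by rewrite sVV.
pose Inv S d := walk_bound d /\ short_via S d.
have -> : n * (n * n).+1 = \sum_(k <- enum 'I_n) (n * n).+1.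
  by rewrite big_const_seq count_predT size_enum_ord iter_addn_0 mulnC.
apply: spec_weaken (spec_foldP (Inv := Inv) _ _) (leqnn _) id _; last first.
- by move=> d [walk_d short_d]; apply: walk_metric.
- move=> S k post d _ [walk_d short_d]; apply: spec_pass; first by rewrite sVV.
  split; last exact: short_via_step.
  move=> i j; rewrite /minn; case: ifP => [_ /walk_d //|_ lt_n].
  have [|p ip [lp sp]] := walk_d i k; first lia.
  have [|q kq [lq sq]] := walk_d k j; first lia.
  exists (p ++ q); first by rewrite cat_path ip lp kq.
  by rewrite last_cat lp lq size_cat sp sq.
split=> [i j|i p ip].
  case: eqP => [-> _|_]; first by exists [::].
  case: ifP => [ij _|]; last by rewrite ltnn.
  by exists [:: j]; rewrite //= ij.
case: p ip => [|x [|y p]] /=; first by rewrite eqxx.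
  by rewrite andbT => -> _ _; case: eqP.
rewrite !inE !negb_or => _ /andP[_ /andP[/andP[xy _] _]] pS.
have xl : x = last y p.
  by apply/eqP/negPn/negP=> /(pS x (mem_head _ _)).
have yl : y = last y p.
  apply/eqP/negPn/negP; rewrite -/(last y p) => /(pS y).
  by rewrite !inE eqxx orbT => /(_ isT).
by rewrite xl -yl eqxx in xy.
Qed.

End FloydWarshall.

(** * Exchanging elements of sets *)

Section Sets.

Variable E : finType.
Implicit Types A B C D : {set E}.

(** Always [A :\: B] is contained in [(A :\: C) :|: (C :\: B)]; the equation of
    sizes leaves no room for an element of only one side. *)
Lemma between_sub A B C : #|A :\: B| = #|A :\: C| + #|C :\: B| ->
  A :&: B \subset C /\ C \subset A :|: B.
Proof.
move=> cAB; have sAB : A :\: B \subset (A :\: C) :|: (C :\: B).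
  apply/subsetP=> x; rewrite !inE => /andP[-> ->].
  by case: (x \in C).
have /eqP EAB : A :\: B == (A :\: C) :|: (C :\: B).
  by rewrite eqEcard sAB cAB -cardsUI leq_addr.
split; apply/subsetP=> x; rewrite !inE; move/setP/(_ x): EAB; rewrite !inE;
  by case: (x \in A); case: (x \in B); case: (x \in C).
Qed.

Definition exchange A a b := b |: (A :\ a).

Lemma exchangeP A C a b :
    #|A :\: C| = 1 -> #|C :\: A| = 1 -> a \in A :\: C -> b \in C :\: A ->
  C = exchange A a b.
Proof.
move=> /eqP/cards1P[a' Ea] /eqP/cards1P[b' Eb]; rewrite Ea Eb !inE.
move=> /eqP-> /eqP->; apply/setP=> x; rewrite !inE.
move/setP/(_ x): Ea; move/setP/(_ x): Eb; rewrite !inE.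
by case: (x \in A); case: (x \in C) => /= <- <-.
Qed.

Lemma exchangeK A a b : a \in A -> b \notin A ->
  exchange (exchange A a b) b a = A.
Proof.
move=> aA bA; apply/setP=> x; rewrite !inE.
have [->|_] := altP (x =P a); first by rewrite aA.
by have [->|_] := altP (x =P b); rewrite // (negPf bA).
Qed.

Lemma exchange_setDl A a b : a \in A -> b \notin A ->
  A :\: exchange A a b = [set a].
Proof.
move=> aA bA; apply/setP=> x; rewrite !inE.
have [->|_] := altP (x =P a).
  by rewrite aA orbF andbT; apply: contraNneq bA => <-.
by case: (x \in A); rewrite ?orbT ?andbF.
Qed.

Lemma exchange_setDr A a b : a \in A -> b \notin A ->
  exchange A a b :\: A = [set b].
Proof.
move=> aA bA; apply/setP=> x; rewrite !inE.
have [->|_] := altP (x =P b); first by rewrite bA.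
by case: (x \in A); rewrite ?andbF.
Qed.

Lemma card_exchange_exchange A a a' b b' :
    a \in A -> a' \in A -> b \notin A -> b' \notin A ->
  #|exchange A a b :\: exchange A a' b'| = (a != a') + (b != b').
Proof.
move=> aA a'A bA b'A.
have ba' : b != a' by apply: contraNneq bA => ->.
have -> : exchange A a b :\: exchange A a' b' =
    [set x | (x == a') && (a != a') || (x == b) && (b != b')].
  apply/setP=> x; rewrite !inE.
  (* what relates the seven tests below; the rest is propositional *)
  have: [&& (x == a) || (x == a') ==> (x \in A),
      (x == b) || (x == b') ==> (x \notin A),
      (a == a') ==> ((x == a) == (x == a')),
      (x == a) && (x == a') ==> (a == a'),
      (b == b') ==> ((x == b) == (x == b'))
    & (x == b) && (x == b') ==> (b == b')].
    do 5?[apply/andP; split]; apply/implyP; try by case/orP=> /eqP->.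
    - by move/eqP->.
    - by case/andP=> /eqP->.
    - by move/eqP->.
    by case/andP=> /eqP->.
  by case: (x == a); case: (x == a'); case: (x == b); case: (x == b');
    case: (a == a'); case: (b == b'); case: (x \in A).
case: (a != a'); case: (b != b') => /=.
- suff -> : [set x | (x == a') && true || (x == b) && true] = [set a'; b].
    by rewrite cards2 eq_sym ba'.
  by apply/setP=> x; rewrite !inE !andbT.
- suff -> : [set x | (x == a') && true || (x == b) && false] = [set a'].
    by rewrite cards1.
  by apply/setP=> x; rewrite !inE andbT andbF orbF.
- suff -> : [set x | (x == a') && false || (x == b) && true] = [set b].
    by rewrite cards1.
  by apply/setP=> x; rewrite !inE andbT andbF.
apply/eqP; rewrite cards_eq0; apply/eqP/setP=> x; rewrite !inE.
by rewrite !andbF.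
Qed.

Section LocalExchange.

Variable Bs : {set {set E}}.
Hypothesis step : forall A B, A \in Bs -> B \in Bs -> A != B ->
  exists a b, [/\ a \in A :\: B, b \in B :\: A & exchange B b a \in Bs].
Hypothesis local : forall A B, A \in Bs -> B \in Bs -> #|A :\: B| = 2 ->
  forall a, a \in A :\: B -> exists b,
    [/\ b \in B :\: A, exchange A a b \in Bs & exchange B b a \in Bs].

(** The set reached from [B] by a double exchange is at distance two from [B], so
    [local] splits the double exchange into two single ones, one for each of the
    two ways to pair the removed with the added elements. *)
Lemma double_exchange B a1 b1 a2 b2 :
    B \in Bs -> a1 \notin B -> a2 \notin B -> a1 != a2 ->
    b1 \in B -> b2 \in B -> b1 != b2 ->
    exchange (exchange B b1 a1) b2 a2 \in Bs ->
  exchange B b1 a1 \in Bs /\ exchange B b2 a2 \in Bs \/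
  exchange B b2 a1 \in Bs /\ exchange B b1 a2 \in Bs.
Proof.
move=> BB a1B a2B a12 b1B b2B b12; set D := exchange _ b2 a2 => DB.
have facts x : [/\ (x == a1) ==> (x \notin B), (x == a2) ==> (x \notin B),
    (x == b1) ==> (x \in B), (x == b2) ==> (x \in B)
    & ~~ ((x == a1) && (x == a2)) && ~~ ((x == b1) && (x == b2))].
  split; try by apply/implyP=> /eqP->.
  by apply/andP; split; apply/negP=> /andP[/eqP->]; apply/negP.
have DB2 : D :\: B = [set a1; a2].
  apply/setP=> x; have [] := facts x; rewrite !inE.
  by case: (x == a1); case: (x == a2); case: (x == b1); case: (x == b2);
    case: (x \in B).
have BD2 : B :\: D = [set b1; b2].
  apply/setP=> x; have [] := facts x; rewrite !inE.
  by case: (x == a1); case: (x == a2); case: (x == b1); case: (x == b2);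
    case: (x \in B).
have [||b] := local DB BB _ (a := a1); rewrite ?DB2 ?cards2 ?a12 ?set21 // BD2.
case=> /set2P[->|->] Db Bb; [left|right]; split=> //; move: Db;
  congr (_ \in Bs); apply/setP=> x; have [] := facts x; rewrite !inE;
  by case: (x == a1); case: (x == a2); case: (x == b1); case: (x == b2);
    case: (x \in B).
Qed.

(** A first step from [B] towards [A] may add [a] itself. Then the second step
    adds another element, and by [double_exchange] the two steps can be taken in
    an order that starts with that element. *)
Lemma exchange_other A B a : A \in Bs -> B \in Bs -> a \in A :\: B ->
    1 < #|A :\: B| ->
  exists a' b', [/\ a' \in A :\: B, a' != a, b' \in B :\: A
    & exchange B b' a' \in Bs].
Proof.
move=> AB BB aAB lt1.
have AneB : A != B by apply: contraTneq lt1 => ->; rewrite setDv cards0.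
have [a1 [b1 [a1AB b1BA CB]]] := step AB BB AneB.
have [a1a|] := altP (a1 =P a); last by exists a1, b1.
subst a1 => {a1AB}; set C := exchange B b1 a in CB.
have AneC : A != C.
  apply: contraTneq lt1 => eqAC; rewrite eqAC -leqNgt.
  move: aAB b1BA; rewrite !inE => /andP[aB _] /andP[_ b1B].
  by rewrite exchange_setDr // cards1.
have [a2 [b2 []]] := step AB CB AneC.
move: aAB b1BA; rewrite !inE !negb_or !negb_and negbK.
move=> /andP[aB aA] /andP[b1A b1B] /andP[/andP[a2a a2B] a2A].
move=> /andP[b2A /orP[/eqP b2a|/andP[b2b1 b2B]]].
  by rewrite b2a aA in b2A.
have {}a2B : a2 \notin B.
  by case/orP: a2B => // /eqP a2b1; rewrite -a2b1 a2A in b1A.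
move: a2a b2b1; rewrite eq_sym (eq_sym b2) => aa2 b12 DB.
have [[_ ?]|[_ ?]] := double_exchange BB aB a2B aa2 b1B b2B b12 DB.
  by exists a2, b2; rewrite !inE a2B a2A b2A b2B eq_sym.
by exists a2, b1; rewrite !inE a2B a2A b1A b1B eq_sym.
Qed.

(** By induction on [#|A :\: B|]. Let [C := B - b' + a'] be a neighbour of [B]
    towards [A] with [a' != a]. The exchange of [a] between [A] and [C] yields
    some [b1]; splitting the double exchange from [B] to [C + a - b1] either
    shows that [b1] is good, or that [B - b1 + a'] and [B - b' + a] are bases.
    In the latter case the same is done with [b1] for [b']: it yields some [b2],
    and now both outcomes of the splitting are good, because [A - a + b1] and
    [A - a + b2] are known to be bases. *)
Lemma local_exchange A B a : A \in Bs -> B \in Bs -> a \in A :\: B ->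
  exists b, [/\ b \in B :\: A, exchange A a b \in Bs & exchange B b a \in Bs].
Proof.
move=> AB BB aAB.
have [k le_k] : exists k, #|A :\: B| <= k by exists #|A :\: B|.
elim: k B le_k BB aAB => [|k IHk] B le_k BB aAB.
  by move: le_k aAB; rewrite leqn0 cards_eq0 => /eqP->; rewrite inE.
have [aB aA] : a \notin B /\ a \in A by move: aAB; rewrite !inE => /andP.
have [lt1|le1] := ltnP 1 #|A :\: B|; last first.
  have AneB : A != B by apply: contraNneq aB => <-.
  have [a1 [b1 [a1AB b1BA CB]]] := step AB BB AneB.
  have E1 : A :\: B = [set a].
    by apply/eqP; rewrite eq_sym eqEcard sub1set aAB cards1.
  move: a1AB CB; rewrite E1 inE => /eqP-> CB; exists b1; split=> //.
  have -> : A = exchange B b1 a.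
    apply/eqP; apply/negPn/negP=> /(step AB CB)[a2 [_ [a2AC _ _]]].
    have : a2 \in A :\: B.
      move: a2AC b1BA; rewrite !inE negb_or negb_and negbK.
      move=> /andP[/andP[_ a2B] a2A] /andP[b1A _]; rewrite a2A andbT.
      by case/orP: a2B => // /eqP a2b1; rewrite -a2b1 a2A in b1A.
    by rewrite E1 inE => /eqP a2a; move: a2AC; rewrite !inE a2a eqxx.
  by move: b1BA; rewrite inE => /andP[_ b1B]; rewrite exchangeK.
have [a' [b' [a'AB a'a b'BA CB]]] := exchange_other AB BB aAB lt1.
have [a'B a'A] : a' \notin B /\ a' \in A by move: a'AB; rewrite !inE => /andP.
have IH b : b \in B :\: A -> exchange B b a' \in Bs -> exists b2,
    [/\ b2 \in B :\: A, exchange A a b2 \in Bs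
      & exchange B b a' \in Bs /\ exchange B b2 a \in Bs \/
        exchange B b2 a' \in Bs /\ exchange B b a \in Bs].
  rewrite !inE => /andP[bA bB] CbB.
  have [||b2 []] := IHk _ _ CbB.
  - rewrite -ltnS; apply: leq_trans le_k; apply: proper_card.
    apply/properP; split; last by exists a'; rewrite // !inE eqxx.
    apply/subsetP=> x; rewrite !inE negb_or negb_and negbK.
    case/andP=> /andP[_ /orP[/eqP->|->]] //; by rewrite (negPf bA).
  - by rewrite !inE aA negb_or negb_and aB orbT eq_sym a'a.
  rewrite !inE => /andP[b2A /orP[/eqP b2a'|/andP[b2b b2B]]].
    by rewrite b2a' a'A in b2A.
  move=> Ab2 DB; exists b2; rewrite inE b2A b2B; split=> //.
  by apply: double_exchange; rewrite // eq_sym.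
have [b1 [b1BA Ab1 [[_ ?]|[Bb1 Bb'a]]]] := IH b' b'BA CB; first by exists b1.
have [b2 [b2BA Ab2 [[_ ?]|[_ ?]]]] := IH b1 b1BA Bb1; first by exists b2.
by exists b1.
Qed.

End LocalExchange.

Theorem local_exchange_matroid (Bs : {set {set E}}) :
    Bs != set0 ->
    (forall A B, A \in Bs -> B \in Bs -> A != B ->
       exists a b, [/\ a \in A :\: B, b \in B :\: A & exchange B b a \in Bs]) ->
    (forall A B, A \in Bs -> B \in Bs -> #|A :\: B| = 2 ->
       forall a, a \in A :\: B -> exists b,
       [/\ b \in B :\: A, exchange A a b \in Bs & exchange B b a \in Bs]) ->
  is_matroid Bs.
Proof.
by move=> Bs0 step local; split=> // A B AB BB a; exact: local_exchange.
Qed.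

End Sets.

(** * Isometric labellings *)

Lemma matroid_metric n (e : rel 'I_n) (E : finType) (l : 'I_n -> {set E}) Bs :
    is_matroid Bs -> exchange_iso e l Bs ->
  graph_metric e (fun u w => #|l u :\: l w|).
Proof.
move=> [_ exch] [inj_l im_l e_l].
have lB u : l u \in Bs by rewrite -im_l imset_f.
split=> [u|x y w|u w uw]; first by rewrite setDv cards0.
  rewrite e_l => /eqP xy; rewrite -addn1 -xy addnC -cardsUI.
  apply: leq_trans (leq_addr _ _); apply/subset_leq_card/subsetP=> z.
  by rewrite !inE => /andP[-> ->]; case: (z \in l y).
have: l u :\: l w != set0.
  apply: contraNneq uw => luw; rewrite -(inj_eq inj_l) eqEsubset.
  rewrite -setD_eq0 luw eqxx /= -setD_eq0; apply/eqP/setP=> a.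
  rewrite [RHS]inE; apply/negP=> /(exch _ _ (lB w) (lB u))[b [+ _ _]].
  by rewrite luw inE.
case/set0Pn=> a auw; have [b [bwu Bu Bw]] := exch _ _ (lB u) (lB w) a auw.
have /imsetP[x _ lx] : exchange (l u) a b \in [set l z | z : 'I_n].
  by rewrite im_l.
have [aw au] : a \notin l w /\ a \in l u by move: auw; rewrite inE => /andP.
have [bu bw] : b \notin l u /\ b \in l w by move: bwu; rewrite inE => /andP.
exists x; first by rewrite e_l /exchange_adj -lx exchange_setDl ?cards1.
rewrite (cardsD1 a) auw -lx add1n; congr (#|pred_of_set _|.+1).
apply/setP=> z; rewrite !inE; have [->|_] := altP (z =P b).
  by rewrite bw ?andbF.
by case: (z == a); rewrite ?andbF.
Qed.

Section Isometric.

Variables (n : nat) (e : rel 'I_n) (E : finType) (l : 'I_n -> {set E}).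
Variable d : 'I_n -> 'I_n -> nat.
Hypotheses (sym_e : symmetric e) (irr_e : irreflexive e).
Hypotheses (md : graph_metric e d) (iso_l : forall u w, #|l u :\: l w| = d u w).

Let edgeE u w : e u w -> d u w = 1.
Proof. by rewrite (metric_edge irr_e md) => /eqP. Qed.

Let d_sym u w : d u w = d w u.
Proof. exact: metric_sym md u w. Qed.

Lemma between_labels u w x : d u w = 2 -> e x u -> e x w ->
  l u :&: l w \subset l x /\ l x \subset l u :|: l w.
Proof.
move=> uw xu xw; apply: between_sub.
by rewrite !iso_l uw (edgeE xw) d_sym (edgeE xu).
Qed.

(** The pairs [u], [v] and [x], [y] are the diagonals of a square, and each
    node of the square lies between the two nodes of the other diagonal. *)
Lemma square_labels v u x y : d u v = 2 -> e x u -> e x v -> e y u -> e y v ->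
    x != y -> ~~ e x y ->
  l u = (l x :&: l y) :|: ((l x :|: l y) :\: l v).
Proof.
move=> uv xu xv yu yv xy Nxy.
have xy2 : d x y = 2.
  by apply: (metric2 sym_e irr_e md xy Nxy (x := u)); rewrite sym_e.
have [/subsetP x1 /subsetP x2] := between_labels uv xu xv.
have [/subsetP y1 /subsetP y2] := between_labels uv yu yv.
have [||/subsetP u1 /subsetP u2] := between_labels xy2 (x := u);
  rewrite 1?sym_e //.
have [||/subsetP v1 /subsetP v2] := between_labels xy2 (x := v);
  rewrite 1?sym_e //.
apply/setP=> z; move: (x1 z) (x2 z) (y1 z) (y2 z) (u1 z) (u2 z) (v1 z) (v2 z).
rewrite !inE; case: (z \in l u); case: (z \in l v); case: (z \in l x);
  case: (z \in l y) => //=; do ?[by move=> /(_ isT)|move=> _|move/(_ isT)].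
Qed.

Lemma square_exchange u w x y : d u w = 2 -> e x u -> e x w -> e y u -> e y w ->
    x != y -> ~~ e x y -> forall a, a \in l u :\: l w ->
  exists b, [/\ b \in l w :\: l u, exchange (l u) a b \in [set l z | z : 'I_n]
              & exchange (l w) b a \in [set l z | z : 'I_n]].
Proof.
move=> uw; wlog suff H : x y / forall a, e x u -> e x w -> e y u -> e y w ->
    x != y -> ~~ e x y -> a \in l u :\: l w -> a \notin l x ->
  exists b, [/\ b \in l w :\: l u, exchange (l u) a b \in [set l z | z : 'I_n]
              & exchange (l w) b a \in [set l z | z : 'I_n]].
  move=> xu xw yu yw xy Nxy a auw.
  have [ax|] := boolP (a \in l x); last exact: (H x y).
  rewrite eq_sym in xy; rewrite sym_e in Nxy; apply: (H y x a) => //.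
  rewrite eq_sym in xy; rewrite sym_e in Nxy.
  have xy2 : d x y = 2.
    by apply: (metric2 sym_e irr_e md xy Nxy (x := u)); rewrite sym_e.
  have [||/subsetP w1 _] := between_labels xy2 (x := w); rewrite 1?sym_e //.
  move: auw; rewrite inE => /andP[aw _]; apply: contra aw => ay.
  by apply: w1; rewrite inE ax.
move=> a xu xw yu yw xy Nxy auw ax.
have xy2 : d x y = 2.
  by apply: (metric2 sym_e irr_e md xy Nxy (x := u)); rewrite sym_e.
have [||/subsetP u1 /subsetP u2] := between_labels xy2 (x := u);
  rewrite 1?sym_e //.
have [||/subsetP w1 /subsetP w2] := between_labels xy2 (x := w);
  rewrite 1?sym_e //.
have [_ /subsetP x2] := between_labels uw xu xw.
have [/subsetP y1 /subsetP y2] := between_labels uw yu yw.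
have [aw au] : a \notin l w /\ a \in l u by move: auw; rewrite inE => /andP.
have /set0Pn[b] : l x :\: l u != set0 by rewrite -card_gt0 iso_l (edgeE xu).
rewrite inE => /andP[bu bx].
have bw : b \in l w by have := x2 b bx; rewrite inE (negPf bu).
have by_ : b \notin l y by apply: contra bu => by_; apply: u1; rewrite inE bx.
have ay : a \in l y by have := u2 a au; rewrite inE (negPf ax).
have lx : l x = exchange (l u) a b.
  by apply: exchangeP; rewrite ?iso_l ?(d_sym u) ?(edgeE xu) ?inE ?ax ?bu.
have ly : l y = exchange (l w) b a.
  by apply: exchangeP; rewrite ?iso_l ?(d_sym w) ?(edgeE yw) ?inE ?by_ ?aw.
by exists b; rewrite inE bu bw -lx -ly !imset_f.
Qed.

(** As the labelling is isometric, a shortest path from [w] to [u] starts with an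
    exchange that brings the label of [w] closer to that of [u]. *)
Theorem isometric_valid :
    0 < n ->
    (forall u w, d u w = 2 -> exists x y,
       [/\ e x u && e x w, e y u && e y w, x != y & ~~ e x y]) ->
  valid_labelling e l.
Proof.
move=> n0 squares; exists [set l u | u : 'I_n]; split; last first.
  split=> // [u w luw|u w]; last first.
    by rewrite /exchange_adj iso_l (metric_edge irr_e md).
  by apply/eqP; rewrite -(metric0 md) -iso_l luw setDv cards0.
apply: local_exchange_matroid.
- by apply/set0Pn; exists (l (Ordinal n0)); apply: imset_f.
- move=> _ _ /imsetP[u _ ->] /imsetP[w _ ->] luw.
  have wu : w != u by apply: contraNneq luw => ->.
  case: (md) => _ _ /(_ _ _ wu)[x wx dwx].
  have := iso_l x w; rewrite d_sym (edgeE wx) => /eqP/cards1P[a Ea].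
  have := iso_l w x; rewrite (edgeE wx) => /eqP/cards1P[b Eb].
  have [/subsetP s1 /subsetP s2] :
      l w :&: l u \subset l x /\ l x \subset l w :|: l u.
    by apply: between_sub; rewrite !iso_l dwx (edgeE wx).
  have: a \in l x :\: l w by rewrite Ea set11.
  have: b \in l w :\: l x by rewrite Eb set11.
  rewrite !inE => /andP[bx bw] /andP[aw ax].
  exists a, b; split.
  + by rewrite inE aw; have := s2 a ax; rewrite inE (negPf aw).
  + by rewrite inE bw andbT; apply: contra bx => bu; apply: s1; rewrite inE bw.
  rewrite -(@exchangeP _ (l w) (l x) b a) ?imset_f ?Ea ?Eb ?cards1 ?set11 //.
- move=> _ _ /imsetP[u _ ->] /imsetP[w _ ->]; rewrite iso_l => uw a auw.
  have [x [y [/andP[xu xw] /andP[yu yw] xy Nxy]]] := squares u w uw.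
  exact: square_exchange uw xu xw yu yw xy Nxy a auw.
Qed.

End Isometric.

(** * Line graphs of bipartite graphs *)

Definition endpoint (X Y : Type) (s : bool) (p : X * Y) : X + Y :=
  if s then inl p.1 else inr p.2.

Lemma endpoint_eq (X Y : eqType) s s' (p q : X * Y) :
  (endpoint s p == endpoint s' q) =
  if s then s' && (p.1 == q.1) else ~~ s' && (p.2 == q.2).
Proof. by case: s; case: s'. Qed.

Definition swap_sides (X Y : Type) (p : X * Y) : Y * X := (p.2, p.1).

Lemma line_adj_swap (X Y : finType) (p q : X * Y) :
  line_adj (swap_sides p) (swap_sides q) = line_adj p q.
Proof.
case: p q => [a b] [c d]; rewrite /line_adj !xpair_eqE /=.
by case: (a == c); case: (b == d).
Qed.

Lemma eq_trans3 (T : eqType) (a b c : T) :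
  [&& (a == b) && (b == c) ==> (a == c), (a == b) && (a == c) ==> (b == c)
    & (b == c) && (a == c) ==> (a == b)].
Proof.
apply/and3P; split; apply/implyP=> /andP[/eqP E1 /eqP E2]; apply/eqP.
- by rewrite E1.
- by rewrite -E1.
by rewrite E1.
Qed.

Section LineRep.

Variables (n : nat) (e : rel 'I_n).
Hypotheses (sym_e : symmetric e) (irr_e : irreflexive e).

Definition line_rep (X Y : finType) (D : {set 'I_n}) (f : 'I_n -> X * Y)
    : Prop :=
  {in D &, injective f} /\ {in D &, forall u w, e u w = line_adj (f u) (f w)}.

Lemma line_rep_swap (X Y : finType) (D : {set 'I_n}) (f : 'I_n -> X * Y) :
  line_rep D f -> line_rep D (fun x => swap_sides (f x)).
Proof.
case=> inj_f e_f; split=> u w uD wD; last by rewrite line_adj_swap e_f.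
move=> [Ey Ex]; apply: inj_f => //.
by rewrite (surjective_pairing (f u)) Ex Ey -surjective_pairing.
Qed.

Lemma line_repS (X Y : finType) (D D' : {set 'I_n}) (f : 'I_n -> X * Y) :
  D' \subset D -> line_rep D f -> line_rep D' f.
Proof.
move=> /subsetP sD [inj_f e_f].
by split=> u w /sD uD /sD wD; [apply: inj_f | apply: e_f].
Qed.

Section OneRep.

Variables (X Y : finType) (D : {set 'I_n}) (f : 'I_n -> X * Y).
Hypothesis fP : line_rep D f.

Lemma line_rep_edge u w : u \in D -> w \in D -> u != w ->
  (e u w = ((f u).1 == (f w).1) || ((f u).2 == (f w).2)) *
  (((f u).1 == (f w).1) && ((f u).2 == (f w).2) = false).
Proof.
move=> uD wD uw; case: fP => inj_f e_f.
have fuw : f u != f w by apply: contraNneq uw => /inj_f->.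
split; first by rewrite e_f // /line_adj fuw.
by apply: contraNF fuw; rewrite -pair_eqE.
Qed.

(** Three pairwise intersecting edges of a bipartite graph share one endpoint,
    whereas two disjoint edges meet a third one at its two endpoints. So the graph
    [e] tells whether the shared endpoint changes sides along [x], [y], [z]. *)
Lemma line_rep_turn x y z : x \in D -> y \in D -> z \in D ->
    e x y -> e y z -> x != z ->
  (((f x).1 == (f y).1) == ((f y).1 == (f z).1)) = e x z.
Proof.
move=> xD yD zD xy yz xz.
have Nxy : x != y by apply: contraTneq xy => ->; rewrite irr_e.
have Nyz : y != z by apply: contraTneq yz => ->; rewrite irr_e.
have [exy nxy] := line_rep_edge xD yD Nxy.
have [eyz nyz] := line_rep_edge yD zD Nyz.
have [exz nxz] := line_rep_edge xD zD xz.
move: xy yz nxy nyz nxz (eq_trans3 (f x).1 (f y).1 (f z).1).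
move: (eq_trans3 (f x).2 (f y).2 (f z).2); rewrite exy eyz exz.
by do 6!case: (_ == _).
Qed.

End OneRep.

Section Flip.

Variables (X Y X' Y' : finType) (D : {set 'I_n}).
Variables (f : 'I_n -> X * Y) (g : 'I_n -> X' * Y').
Hypotheses (fP : line_rep D f) (gP : line_rep D g).

(** Whether [f] and [g] disagree on the side of the endpoint that [x] shares with
    its neighbours; by [flipE] all neighbours give the same answer. *)
Definition flip x : bool := [exists z, [&& z \in D, e x z
  & ((f x).1 == (f z).1) != ((g x).1 == (g z).1)]].

Lemma flipE x z : x \in D -> z \in D -> e x z ->
  flip x = (((f x).1 == (f z).1) != ((g x).1 == (g z).1)).
Proof.
move=> xD zD xz; apply/existsP/idP => [[z' /and3P[z'D xz']]|fg]; last first.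
  by exists z; apply/and3P.
have [<-//|Nzz'] := altP (z =P z').
rewrite sym_e in xz; have := line_rep_turn fP zD xD z'D xz xz' Nzz'.
rewrite -(line_rep_turn gP zD xD z'D xz xz' Nzz').
rewrite (eq_sym (f z).1) (eq_sym (g z).1).
by case: ((f x).1 == (f z).1); case: ((f x).1 == (f z').1);
  case: ((g x).1 == (g z).1); case: ((g x).1 == (g z').1).
Qed.

Lemma flip_edge x z : x \in D -> z \in D -> e x z -> flip x = flip z.
Proof.
move=> xD zD xz; rewrite (flipE xD zD xz) (flipE zD xD) 1?sym_e //.
by rewrite (eq_sym (f x).1) (eq_sym (g x).1).
Qed.

(** The uniqueness of the bipartite graph of a line graph: the endpoints of the
    edges [f x] and [g x] correspond to each other, up to a swap of sides that is
    constant on the components ([flip_edge]). *)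
Theorem line_rep_unique s s' x z : x \in D -> z \in D ->
  (endpoint s (f x) == endpoint s' (f z)) =
  (endpoint (s (+) flip x) (g x) == endpoint (s' (+) flip z) (g z)).
Proof.
move=> xD zD; rewrite !endpoint_eq; have [<-|Nxz] := altP (x =P z).
  by rewrite !eqxx; case: s; case: s'; case: (flip x).
have [ef Nf] := line_rep_edge fP xD zD Nxz.
have [eg Ng] := line_rep_edge gP xD zD Nxz.
have [xz|] := boolP (e x z); last first.
  rewrite ef => Nfx; move: (Nfx); rewrite -ef eg.
  move: Nfx; rewrite !negb_or => /andP[/negPf-> /negPf->].
  move=> /andP[/negPf-> /negPf->].
  by case: s; case: s'; case: (flip x); case: (flip z).
rewrite -(flip_edge xD zD xz); have := flipE xD zD xz.
move: xz (xz) Nf Ng; rewrite {1}ef eg; case: (flip x); case: s; case: s';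
by case: ((f x).1 == (f z).1); case: ((f x).2 == (f z).2);
  case: ((g x).1 == (g z).1); case: ((g x).2 == (g z).2).
Qed.

End Flip.

End LineRep.

(** * Finding the original graph of a line graph *)

Section OriginalGraph.

Variables (n : nat) (e : rel 'I_n).
Hypotheses (sym_e : symmetric e) (irr_e : irreflexive e).

(** Suppose that [g], an edge assignment that includes [x], agrees with [f] around
    the neighbours of [x], and that in [g] the edge of [x] shares its first
    endpoint with that of [y]. Then the edge of [x] is forced: the neighbours of
    [x] that do not share this endpoint all share the other one. If there are
    none, any new endpoint will do. *)
Lemma line_extension (X Y X' Y' : finType) (D : {set 'I_n})
    (f : 'I_n -> X * Y) (g : 'I_n -> X' * Y') x y c :
    x \notin D -> line_rep e D f -> line_rep e (x |: D) g ->
    y \in D -> e x y -> (g x).1 = (g y).1 ->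
    {in D &, forall z z', e x z -> e z z' ->
      ((f z).1 == (f z').1) = ((g z).1 == (g z').1)} ->
    (exists2 z, z \in D & [/\ e x z, (f z).1 != (f y).1 & c = (f z).2])
    \/ {in D, forall z, (e x z -> (f z).1 = (f y).1) /\ (f z).2 != c} ->
  {in D, forall z,
    (f z != ((f y).1, c)) && (e x z == line_adj (f z) ((f y).1, c))}.
Proof.
move=> xD fP gP yD xy gxy fg cP z zD.
have inxD w : w \in D -> w \in x |: D by move=> wD; rewrite inE wD orbT.
have gDP : line_rep e D g by apply: line_repS gP; apply: subsetUr.
have neq w : w \in D -> w != x by apply: contraTneq => ->.
have agree w w' : w \in D -> e x w -> w' \in D ->
    ((f w).1 == (f w').1) = ((g w).1 == (g w').1) /\
    ((f w).2 == (f w').2) = ((g w).2 == (g w').2).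
  move=> wD xw w'D; have [<-|Nww'] := altP (w =P w'); first by rewrite !eqxx.
  have [ef nf] := line_rep_edge fP wD w'D Nww'.
  have [eg ng] := line_rep_edge gDP wD w'D Nww'.
  move: (fg w w' wD w'D xw) nf ng ef; rewrite eg.
  by case: ((f w).1 == _); case: ((f w).2 == _); case: ((g w).1 == _);
    case: ((g w).2 == _) => // /(_ isT).
have row : ((f z).1 == (f y).1) = ((g z).1 == (g x).1).
  by rewrite eq_sym (agree y z yD xy zD).1 eq_sym gxy.
have gcol w : w \in D -> e x w -> (g w).1 != (g x).1 -> (g w).2 = (g x).2.
  move=> wD; rewrite sym_e.
  have [-> _] := line_rep_edge gP (inxD w wD) (setU11 x D) (neq w wD).
  by case/orP=> [->|/eqP].
have [ezx Nzx] := line_rep_edge gP (inxD z zD) (setU11 x D) (neq z zD).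
have col : ((f z).2 == c) = ((g z).2 == (g x).2).
  case: cP => [[w wD [xw fwy ->]]|cN].
    rewrite eq_sym (agree w z wD xw zD).2 eq_sym; congr (_ == _).
    by apply: gcol => //; rewrite gxy -(agree w y wD xw yD).1.
  have [xz_y /negPf->] := cN z zD; apply/esym/negP=> gz2; move: Nzx.
  rewrite gz2 andbT -row xz_y ?eqxx // sym_e ezx gz2 orbT //.
have Ef : (f z == ((f y).1, c)) = ((g z).1 == (g x).1) && ((g z).2 == (g x).2).
  by rewrite -row -col -pair_eqE.
by rewrite /line_adj /= Ef Nzx row col sym_e ezx eqxx.
Qed.

(** For [D] inside [H] this says that each component of the subgraph induced by
    [H] meets [D] in a set that induces a connected subgraph, or not at all. In
    this form it applies directly to [flip], and no paths have to be followed
    when [D] grows. *)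
Definition flips_extend (H D : {set 'I_n}) : Prop :=
  forall p : 'I_n -> bool, {in D &, forall y z, e y z -> p y = p z} ->
  exists2 q : 'I_n -> bool,
    {in H &, forall y z, e y z -> q y = q z} & {in D, q =1 p}.

Lemma flips_extend_neighbour (H D : {set 'I_n}) x y :
    x \in H -> D \subset H -> y \in D -> e x y -> flips_extend H D ->
  flips_extend H (x |: D).
Proof.
move=> xH /subsetP sDH yD xy ext p pP.
have inxD w : w \in D -> w \in x |: D by move=> wD; rewrite inE wD orbT.
have [|q qP qp] := ext p.
  by move=> z w zD wD; apply: pP; apply: inxD.
exists q => // z /setU1P[->|]; last exact: qp.
by rewrite (qP x y xH (sDH y yD) xy) qp // (pP x y) ?setU11 ?inxD.
Qed.

Lemma flips_extend_fresh (H D : {set 'I_n}) x :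
    D \subset H -> {in H & D, forall z y, z \notin D -> ~~ e z y} ->
    flips_extend H D ->
  flips_extend H (x |: D).
Proof.
move=> /subsetP sDH closed_D ext p pP.
have inxD w : w \in D -> w \in x |: D by move=> wD; rewrite inE wD orbT.
exists (fun z => if z \in D then p z else p x)
  => [y z yH zH yz|z /setU1P[->|->] //].
  have [yD|yD] := boolP (y \in D); have [zD|zD] := boolP (z \in D) => //.
  - by apply: pP; rewrite ?inxD.
  - by have := closed_D z y zH yD zD; rewrite sym_e yz.
  by have := closed_D y z yH zD yD; rewrite yz.
by case: ifP.
Qed.

Definition fits (D : {set 'I_n}) (f : 'I_n -> 'I_n * 'I_n) x p : Prop :=
  {in D, forall z, (f z != p) && (e x z == line_adj (f z) p)}.

(** By [flips_extend], the difference between [f] and the true assignment [g] is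
    the same at all neighbours [z] of [x] in [D]. After swapping the sides of [g]
    if necessary, [f] and [g] agree there, and [line_extension] applies, on the
    first or on the second side according to the endpoint that the edge of [x]
    shares with the edge of [y] in [g]. *)
Lemma original_graph_candidates (X Y : finType) (H : seq 'I_n) (D : {set 'I_n})
    (f : 'I_n -> 'I_n * 'I_n) (g : 'I_n -> X * Y) x y :
    x \in H -> x \notin D -> D \subset [set z in H] -> line_rep e D f ->
    {in D, forall z, (f z).1 != x /\ (f z).2 != x} ->
    flips_extend [set z in H] D -> line_rep e [set z in H] g ->
    y \in D -> e x y ->
  let P := [seq z <- H | (z \in D) && e x z] in
  let Pr := [seq z <- P | (f z).1 != (f y).1] in
  let Pc := [seq z <- P | (f z).2 != (f y).2] in
  let p1 := ((f y).1, if Pr is z :: _ then (f z).2 else x) in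
  let p2 := (if Pc is z :: _ then (f z).1 else x, (f y).2) in
  fits D f x p1 \/ fits D f x p2.
Proof.
move=> xH xD sDH fP fresh_x ext gP yD xy P Pr Pc p1 p2.
have DH z : z \in D -> z \in H by move/(subsetP sDH); rewrite inE.
have memP z : (z \in P) = (z \in D) && e x z.
  rewrite mem_filter andb_idr // => /andP[zD _]; exact: DH.
have sxDH : x |: D \subset [set z in H].
  by apply/subsetP=> z; rewrite !inE => /orP[/eqP->|/DH].
have gxDP : line_rep e (x |: D) g := line_repS sxDH gP.
have gDP : line_rep e D g := line_repS sDH gP.
have [q qP qflip] := ext (flip e D f g) (flip_edge sym_e irr_e fP gDP).
have flip_nbr z : z \in D -> e x z -> flip e D f g z = q x.
  move=> zD xz; rewrite -qflip //.
  by apply: qP; [rewrite inE DH|rewrite inE|rewrite sym_e].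
have inxD w : w \in D -> w \in x |: D by move=> wD; rewrite inE wD orbT.
have key (X' Y' : finType) (g' : 'I_n -> X' * Y') (f' : 'I_n -> 'I_n * 'I_n) :
    line_rep e D f' -> line_rep e (x |: D) g' ->
    {in D, forall z, (f' z).2 != x} ->
    (forall z z', z \in D -> e x z -> z' \in D -> e z z' ->
      ((f' z).1 == (f' z').1) = ((g' z).1 == (g' z').1)) ->
    (g' x).1 = (g' y).1 ->
    {in D, forall z, let p := ((f' y).1,
        if [seq z <- P | (f' z).1 != (f' y).1] is z :: _ then (f' z).2 else x)
      in
      (f' z != p) && (e x z == line_adj (f' z) p)}.
  move=> f'P g'P fr agree gxy; apply: (line_extension (g := g')) => //.
    by move=> z z' zD z'D xz zz'; apply: agree.
  case Es: [seq z <- P | _] => [|z s]; [right=> z zD|left]; last first.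
    have: z \in [seq z <- P | (f' z).1 != (f' y).1].
      by rewrite Es mem_head.
    by rewrite mem_filter memP => /and3P[? ? ?]; exists z.
  split; last exact: fr.
  move=> xz; apply/eqP/negPn/negP=> fz.
  have: z \in [seq z <- P | (f' z).1 != (f' y).1].
    by rewrite mem_filter fz memP zD.
  by rewrite Es.
have agree z z' : z \in D -> e x z -> z' \in D -> e z z' ->
    (((f z).1 == (f z').1) != ((g z).1 == (g z').1)) = q x.
  move=> zD xz z'D zz'.
  by rewrite -(flipE sym_e irr_e fP gDP zD z'D zz') flip_nbr.
have Nzz' z z' : e z z' -> z != z' by apply: contraTneq => ->; rewrite irr_e.
have other (X' Y' : finType) (D' : {set 'I_n}) (h : 'I_n -> X' * Y') :
  line_rep e D' h -> {in D' &, forall z z', e z z' ->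
    ((h z).2 == (h z').2) = ((h z).1 != (h z').1)}.
  move=> hP z z' zD zD' zz'; have := line_rep_edge hP zD zD' (Nzz' _ _ zz').
  rewrite zz'; case: (_ == _); case: (_ == _) => //; by case.
have Nxy := Nzz' _ _ xy.
rewrite /fits; have swap_fits f' p :
   (forall z, z \in D -> (swap_sides (f' z) != swap_sides p)
     && (e x z == line_adj (swap_sides (f' z)) (swap_sides p))) ->
   forall z, z \in D -> (f' z != p) && (e x z == line_adj (f' z) p).
  move=> h z zD; have := h z zD; rewrite line_adj_swap; congr (_ && _).
  by case: (f' z) (p) => [a b] [a' b']; rewrite /swap_sides /= !xpair_eqE andbC.
have [X1 [Y1 [h [hP h_agree]]]] :
    exists (X1 Y1 : finType) (h : 'I_n -> X1 * Y1), line_rep e (x |: D) h /\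
    forall z z', z \in D -> e x z -> z' \in D -> e z z' ->
      ((f z).1 == (f z').1) = ((h z).1 == (h z').1).
  case qx: (q x) agree => agree;
    [exists Y, X, (fun z => swap_sides (g z)) | exists X, Y, g].
    split=> [|z z' zD xz z'D zz']; first exact: line_rep_swap.
    rewrite /= (other _ _ _ _ gDP) //; have := agree z z' zD xz z'D zz'.
    by case: ((f z).1 == _); case: ((g z).1 == _).
  split=> // z z' zD xz z'D zz'; have := agree z z' zD xz z'D zz'.
  by case: ((f z).1 == _); case: ((g z).1 == _).
have [eh _] := line_rep_edge hP (setU11 x D) (inxD y yD) Nxy.
have [hr|hc] : (h x).1 = (h y).1 \/ (h x).2 = (h y).2.
  by move: eh; rewrite xy => /esym/orP[]/eqP; [left|right].
- by left; apply: (key _ _ h f) => // z /fresh_x[].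
right; apply: swap_fits.
apply: (key _ _ (fun z => swap_sides (h z)) (fun z => swap_sides (f z))) => //.
- exact: line_rep_swap.
- exact: line_rep_swap.
- by move=> z /fresh_x[].
move=> z z' zD xz z'D zz'; rewrite /= (other _ _ _ _ fP) //.
by rewrite (other _ _ _ _ hP) ?inxD // h_agree.
Qed.

(** The invariant of the main loop. The endpoints in use have names in [D], so the
    name of a new node is fresh. *)
Definition partial_graph (H : seq 'I_n) (pre : seq 'I_n)
    (Dphi : {set 'I_n} * ('I_n -> 'I_n * 'I_n)) : Prop :=
  let: (D, phi) := Dphi in
  [/\ #|D| = size pre, D \subset [set z in H], line_rep e D phi,
      {in D, forall z, (phi z).1 \in D /\ (phi z).2 \in D}
    & flips_extend [set z in H] D].

Lemma partial_graph_extend (H pre : seq 'I_n) (D : {set 'I_n})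
    (phi : 'I_n -> 'I_n * 'I_n) i x p :
    x \in H -> x \notin D -> partial_graph H pre (D, phi) ->
    p.1 \in x |: D -> p.2 \in x |: D ->
    {in D, forall z, (phi z != p) && (e x z == line_adj (phi z) p)} ->
    flips_extend [set z in H] (x |: D) ->
  partial_graph H (rcons pre i) (x |: D, set_at phi x p).
Proof.
move=> xH xD [cD sDH [inj_phi e_phi] phiD _] p1 p2 fits ext.
have inxD w : w \in D -> w \in x |: D by move=> wD; rewrite inE wD orbT.
have at_x : set_at phi x p x = p by rewrite /set_at eqxx.
have at_D z : z \in D -> set_at phi x p z = phi z.
  by move=> zD; rewrite /set_at; case: eqP => // zx; rewrite -zx zD in xD.
split=> //.
- by rewrite cardsU1 xD cD size_rcons add1n.
- by apply/subsetP=> z /setU1P[->|/(subsetP sDH)//]; rewrite inE.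
- split=> u w /setU1P[->|uD] /setU1P[->|wD]; rewrite ?at_x ?at_D //.
  + by move=> pE; have := fits w wD; rewrite pE eqxx.
  + by move=> pE; have := fits u uD; rewrite pE eqxx.
  + exact: inj_phi.
  + by rewrite irr_e /line_adj eqxx.
  + have /andP[_ /eqP->] := fits w wD.
    by rewrite /line_adj eq_sym (eq_sym p.1) (eq_sym p.2).
  + by rewrite sym_e; have /andP[_ /eqP->] := fits u uD.
  exact: e_phi.
move=> z /setU1P[->|zD]; rewrite ?at_x ?at_D //.
by have [z1 z2] := phiD z zD; rewrite !inxD.
Qed.

Lemma original_graph_spec (H : seq 'I_n) : uniq H ->
  spec (20 * n ^ 3) (~ line_graph_of_bipartite e H)
    (fun phi => exists K : {set 'I_n * 'I_n}, line_iso e H K phi)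
    (original_graph e H).
Proof.
move=> uH; have sH : size H <= n.
  by rewrite -(card_uniqP uH) -[leqRHS]card_ord max_card.
have sHH : size [seq (x, y) | x <- H, y <- H] <= n * n.
  by rewrite size_allpairs leq_mul.
pose c := n + (n * n + (1 + (n + (n + (n + (n + (n + 1))))))).
have bound_c : n + (n + (n * c.+1 + 0)) <= 20 * n ^ 3.
  by rewrite /c; case: (n) => // k; rewrite !expnS; nia.
apply: spec_le bound_c _; rewrite /original_graph.
apply: spec_bind_pass; first by rewrite size_enum_ord.
apply: spec_bind_pass; first by rewrite size_enum_ord.
apply: (spec_bind_foldP (Inv := partial_graph H)) => //.
- split=> //; first by rewrite cards0.
  + exact: sub0set.
  + by split=> u w; rewrite inE.
  by move=> p _; exists (fun _ => true) => // z; rewrite inE.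
- move=> pre i post [D phi] EH inv.
  have [cD sDH phiP phiD ext] := inv.
  rewrite {}/c; set rest := [seq x <- H | x \notin D].
  apply: spec_bind_pass => //.
  set front := [seq x <- rest | has _ H].
  apply: spec_bind_pass => //.
  have restN0 : rest != [::].
    rewrite -size_eq0 size_filter -lt0n -has_count; apply/hasPn => all_D.
    suff : size H <= #|D| by rewrite cD EH size_cat /= addnS ltnNge leq_addr.
    rewrite -(card_uniqP uH); apply/subset_leq_card/subsetP=> z /all_D.
    by rewrite negbK.
  apply: spec_bind_pick => [|x x_in]; first by case: (front).
  have [x_rest x_front] : x \in rest /\ (front = [::] \/ x \in front).
    case Ef: front x_in => [|a s] x_in; first by split=> //; left.
    by split; [move: x_in; rewrite -Ef mem_filter => /andP[] | right].
  have [xD xH] : x \notin D /\ x \in H.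
    by move: x_rest; rewrite mem_filter => /andP.
  have DH z : z \in D -> z \in H by move/(subsetP sDH); rewrite inE.
  have in_frontE z : (z \in front) =
      [&& has (fun y => (y \in D) && e z y) H, z \notin D & z \in H].
    by rewrite !mem_filter.
  have fresh z : z \in D -> (phi z).1 != x /\ (phi z).2 != x.
    by move=> /phiD[z1 z2]; split; apply: contraNneq xD => <-.
  apply: spec_bind_pass => //; set P := [seq y <- H | (y \in D) && e x y].
  have sP : size P <= n by rewrite size_filter (leq_trans (count_size _ _)).
  have memP z : (z \in P) = (z \in D) && e x z.
    by rewrite mem_filter andb_idr // => /andP[/DH].
  have cand : line_graph_of_bipartite e H -> forall y, y \in P ->
      let Pr := [seq z <- P | (phi z).1 != (phi y).1] in
      let Pc := [seq z <- P | (phi z).2 != (phi y).2] in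
      let p1 := ((phi y).1, if Pr is z :: _ then (phi z).2 else x) in
      let p2 := (if Pc is z :: _ then (phi z).1 else x, (phi y).2) in
      fits D phi x p1 \/ fits D phi x p2.
    move=> [X [Y [K [g [inj_g _ e_g]]]]] y; rewrite memP => /andP[yD xy].
    apply: (original_graph_candidates (g := g)) => //.
    by split=> u w; rewrite !inE => uH' wH; [apply: inj_g | apply: e_g].
  clearbody P; case: P sP memP cand => [|y Q] sP memP cand.
    apply: spec_ret; apply: partial_graph_extend => //=.
    - exact: setU11.
    - exact: setU11.
    - move=> z zD; have /esym := memP z; rewrite zD in_nil /= => xz.
      have [/negPf z1 /negPf z2] := fresh z zD.
      by rewrite xz /line_adj -pair_eqE /pair_eq /= z1 z2.
    (* a node next to [D] would be in the front and picked instead of [x] *)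
    apply: flips_extend_fresh => // z w; rewrite !inE => zH wD zD.
    apply/negP=> zw; case: x_front => [f0|].
      have : z \in front.
        rewrite in_frontE zD zH !andbT.
        by apply/hasP; exists w; rewrite ?DH ?wD.
      by rewrite f0.
    rewrite in_frontE => /andP[/hasP[w' _ w'P] _].
    by have := memP w'; rewrite w'P.
  have [yD xy] : y \in D /\ e x y.
    by have := memP y; rewrite mem_head => /esym/andP.
  have [y1 y2] := phiD y yD.
  have := fun LG => cand LG y (mem_head _ _); case Ey: (phi y) y1 y2 => [r c].
  rewrite ![(r, c).1]/= ![(r, c).2]/=; cbv beta iota zeta => rD cD' candy.

  apply: spec_bind_pass => //; set Pr := [seq z <- _ | _].
  apply: spec_bind_pass => //; set Pc := [seq z <- _ | _].
  have PrD z : z \in Pr -> z \in D.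
    by rewrite mem_filter memP => /and3P[].
  have PcD z : z \in Pc -> z \in D.
    by rewrite mem_filter memP => /and3P[].
  move: candy; rewrite -/Pr -/Pc.
  set p1 := (r, _); set p2 := (_, c) => candy.
  have fitsP p : reflect (fits D phi x p) (all (fun z => (z \in D) ==>
      (phi z != p) && (e x z == line_adj (phi z) p)) H).
    apply: (iffP allP) => [h z zD|h z zH]; last by apply/implyP; apply: h.
    by apply: (implyP (h z (DH z zD))).
  apply: spec_bind_pass => //; apply: spec_bind_pass => //.
  set cands := _ ++ _.
  have cands_in p : p \in cands -> (p = p1 \/ p = p2) /\ fits D phi x p.
    rewrite mem_cat => /orP[]; case: fitsP => // h; rewrite inE => /eqP->.
      by split; [left|].
    by split; [right|].
  have candsN0 : line_graph_of_bipartite e H -> cands != [::].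
    rewrite /cands => /candy[/fitsP->|/fitsP->] //.
    by case: (all _ _).
  case: cands cands_in candsN0 => [_ N0|p0 s cands_in _].
    by apply: spec_reject => /N0.
  apply: spec_bind_pick => // p /cands_in[p12 p_fits].
  apply: spec_ret; apply: partial_graph_extend => //.
  - case: p12 => ->; rewrite /= inE ?rD ?orbT //.
    case: (Pc) PcD => [|z ?] PcD; first by rewrite set11.
    by rewrite (phiD z _).1 ?orbT // PcD ?mem_head.
  - case: p12 => ->; rewrite /= inE ?cD' ?orbT //.
    case: (Pr) PrD => [|z ?] PrD; first by rewrite set11.
    by rewrite (phiD z _).2 ?orbT // PrD ?mem_head.
  by apply: flips_extend_neighbour xy _; rewrite ?inE.
move=> [D phi] [cD sDH [inj_phi e_phi] _ _].
have ED : D = [set z in H].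
  apply/eqP; rewrite eqEcard sDH cD -(card_uniqP uH) leq_eqVlt.
  by apply/orP; left; apply/eqP/eq_card=> z; rewrite inE.
subst D; apply: spec_ret; exists [set phi w | w in H]; split=> //= u w uH' wH.
  by apply: inj_phi; rewrite inE.
by apply: e_phi; rewrite inE.
Qed.

End OriginalGraph.

(** * Common neighbour subgraphs *)

Section Figures.

Variables (n : nat) (e : rel 'I_n).
Hypotheses (sym_e : symmetric e) (irr_e : irreflexive e).

(** The feature of the three figures that yields symmetric exchanges: for two
    nodes that are not adjacent there are two others that are not adjacent. *)
Definition opposite_pairs (m : nat) (fig : rel nat) : bool :=
  all (fun i => all (fun j => (i != j) && ~~ fig i j ==>
    has (fun k => has (fun h => uniq [:: i; j; k; h] && ~~ fig k h)
      (iota 0 m)) (iota 0 m)) (iota 0 m)) (iota 0 m).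

Lemma has_figure_opposite m fig x0 s u w :
    opposite_pairs m fig -> has_figure e m fig x0 s -> uniq s ->
    u \in s -> w \in s -> u != w -> ~~ e u w ->
  exists x y, [/\ x \in s, y \in s, uniq [:: u; w; x; y] & ~~ e x y].
Proof.
move=> opp /andP[/eqP sm /hasP[t]]; rewrite mem_permutations => ts e_t us.
have ut : uniq t by rewrite (perm_uniq ts).
have tm : size t = m by rewrite (perm_size ts).
rewrite -!(perm_mem ts) => ut_ wt uw Nuw.
have edge i j : i < m -> j < m -> e (nth x0 t i) (nth x0 t j) = fig i j.
  move=> im jm; apply/eqP; move/allP: e_t => /(_ i).
  rewrite mem_iota /= => /(_ im).
  by move/allP=> /(_ j); rewrite mem_iota /=; apply.
pose i := index u t; pose j := index w t.
have [im jm] : i < m /\ j < m by rewrite -tm !index_mem.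
have [Ei Ej] : nth x0 t i = u /\ nth x0 t j = w by rewrite !nth_index.
have ij : i != j by apply: contraNneq uw => ij; rewrite -Ei -Ej ij.
move/allP: opp => /(_ i); rewrite mem_iota /= => /(_ im)/allP/(_ j).
rewrite mem_iota /= => /(_ jm); rewrite ij -edge // Ei Ej Nuw.
case/hasP=> k; rewrite mem_iota /= => km /hasP[h]; rewrite mem_iota /= => hm.
case/andP=> uijkh Nkh; exists (nth x0 t k), (nth x0 t h).
rewrite -edge // in Nkh.
split=> //; [by rewrite -(perm_mem ts) mem_nth ?tm..|].
rewrite -Ei -Ej. change (uniq (map (nth x0 t) [:: i; j; k; h])).
rewrite map_inj_in_uniq // => a b; rewrite !inE.
have lt_m c : [|| c == i, c == j, c == k | c == h] -> c < size t.
  by rewrite tm; case/or4P=> /eqP->.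
by move=> /lt_m am /lt_m bm /eqP; rewrite nth_uniq // => /eqP.
Qed.

Lemma good_subgraph_opposite u w : u != w -> ~~ e u w ->
    good_neighbour_subgraph e u w [seq x <- enum 'I_n | e x u && e x w] ->
  exists x y, [/\ e x u && e x w, e y u && e y w, x != y & ~~ e x y].
Proof.
move=> uw Nuw; set common := [seq x <- _ | _].
have in_common x : (x \in common) = e x u && e x w.
  by rewrite mem_filter mem_enum andbT.
have us : uniq [:: u, w & common].
  rewrite /= inE (negPf uw) !in_common !irr_e ?andbF /=.
  by rewrite filter_uniq ?enum_uniq.
have su : u \in [:: u, w & common] by rewrite inE eqxx.
have sw : w \in [:: u, w & common] by rewrite !inE eqxx orbT.
rewrite /good_neighbour_subgraph => good.
have [x [y [xs ys]]] : exists x y, [/\ x \in [:: u, w & common],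
    y \in [:: u, w & common], uniq [:: u; w; x; y] & ~~ e x y].
  by case/or3P: good => /has_figure_opposite; apply.
rewrite /= !inE !negb_or => /and4P[/and3P[_ ux uy] /andP[wx wy] xy _] Nxy.
exists x, y; rewrite -!in_common; split=> //.
  by move: xs; rewrite !inE eq_sym (negPf ux) eq_sym (negPf wx).
by move: ys; rewrite !inE eq_sym (negPf uy) eq_sym (negPf wy).
Qed.

(** Besides [x] and [y] there are at most two common neighbours, which must be
    the opposite pair that completes the octahedron. Zero, one and two of them
    give the square, the pyramid and the octahedron. *)
Lemma opposite_good_subgraph u w x y :
    u != w -> ~~ e u w -> e x u && e x w -> e y u && e y w ->
    x != y -> ~~ e x y ->
    (forall z, e z u && e z w -> z != x -> z != y -> e x z && e y z) ->
    (forall z z', e z u && e z w -> z != x -> z != y ->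
      e z' u && e z' w -> z' != x -> z' != y -> z != z' -> ~~ e z z') ->
    (forall z1 z2 z3,
       e z1 u && e z1 w -> e z2 u && e z2 w -> e z3 u && e z3 w ->
      ~~ uniq [:: x; y; z1; z2; z3]) ->
  good_neighbour_subgraph e u w [seq x <- enum 'I_n | e x u && e x w].
Proof.
move=> uw Nuw cx cy xy Nxy adj nadj no3; set common := [seq x <- _ | _].
have in_common z : (z \in common) = e z u && e z w.
  by rewrite mem_filter mem_enum andbT.
have uc : uniq common by rewrite filter_uniq ?enum_uniq.
have us : uniq [:: u, w & common].
  by rewrite /= inE (negPf uw) !in_common !irr_e ?andbF /=.
pose rest := [seq z <- common | (z != x) && (z != y)].
have in_rest z : (z \in rest) = [&& z != x, z != y & e z u && e z w].
  by rewrite mem_filter in_common -andbA.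
have urest : uniq rest by rewrite filter_uniq.
have perm_c : perm_eq [:: u, x, w, y & rest] [:: u, w & common].
  rewrite perm_cons (perm_catCA [:: x] [:: w]) perm_cons /=.
  apply: uniq_perm => // [|z].
    by rewrite /= inE !in_rest !eqxx (negPf xy) /= andbF.
  rewrite !inE in_rest in_common.
  have [->|_] := altP (z =P x); first by rewrite cx.
  by have [->|_] := altP (z =P y); first by rewrite cy.
have fig m fg t : perm_eq t [:: u, x, w, y & rest] -> size t = m ->
    all (fun i => all (fun j => e (nth u t i) (nth u t j) == fg i j) (iota 0 m))
      (iota 0 m) -> has_figure e m fg u [:: u, w & common].
  move=> pt tm e_t.
  rewrite /has_figure -(perm_size perm_c) -(perm_size pt) tm eqxx.
  by apply/hasP; exists t; rewrite // mem_permutations (perm_trans pt).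
have [xu xw] := andP cx; have [yu yw] := andP cy.
have sE a b : e a b -> e b a by rewrite sym_e.
have base := (negPf Nuw, negPf Nxy, xu, xw, yu, yw, sE _ _ xu, sE _ _ xw,
  sE _ _ yu, sE _ _ yw, irr_e).
have [nwu nyx] : e w u = false /\ e y x = false.
  by rewrite !(sym_e w) !(sym_e y) !base.
rewrite /good_neighbour_subgraph.
have restP z : z \in rest -> [/\ e z u, e z w, e x z & e y z].
  rewrite in_rest => /and3P[zx zy cz]; have /andP[? ?] := cz.
  by have /andP[? ?] := adj z cz zx zy.
have all_rest z : z \in rest -> e z u && e z w.
  by rewrite in_rest => /and3P[].
case Er: rest urest fig restP => [|r [|s [|z3 r']]] urest fig restP.
- apply/orP; left; apply: (fig _ _ [:: u; x; w; y]) => //.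
  by rewrite /= !base nwu nyx.
- have [ru rw xr yr] := restP r (mem_head _ _).
  apply/orP; right; apply/orP; left; apply: (fig _ _ [:: u; x; w; y; r]) => //.
  by rewrite /= !base nwu nyx ru rw xr yr
    !(sE _ _ ru, sE _ _ rw, sE _ _ xr, sE _ _ yr).
- have [ru rw xr yr] := restP r (mem_head _ _).
  have sr : s \in [:: r; s] by rewrite !inE eqxx orbT.
  have [su sw xs ys] := restP s sr.
  have rs : e r s = false.
    apply: negbTE; have := in_rest r; have := in_rest s.
    rewrite Er sr mem_head => /esym/and3P[? ? ?] /esym/and3P[? ? ?].
    by apply: nadj => //; move: urest; rewrite /= inE andbT.
  have sr' : e s r = false by rewrite sym_e.
  apply/orP; right; apply/orP; right.
  apply: (fig _ _ [:: u; x; r; w; y; s]) => //.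
    rewrite !perm_cons (perm_catCA [:: r] [:: w; y]) //.
  by rewrite /= !base nwu nyx ru rw xr yr su sw xs ys rs sr'
    !(sE _ _ ru, sE _ _ rw, sE _ _ xr, sE _ _ yr)
    !(sE _ _ su, sE _ _ sw, sE _ _ xs, sE _ _ ys).
suff N3 : uniq [:: x; y; r; s; z3].
  have := no3 r s z3; rewrite N3 => /(_ _ _ _)/negP; case=> //;
    by apply: all_rest; rewrite Er !inE eqxx ?orbT.
have xr : x \notin rest by rewrite in_rest eqxx.
have yr : y \notin rest by rewrite in_rest eqxx andbF.
have : uniq [:: x, y & rest] by rewrite /= inE negb_or xy xr yr Er.
rewrite Er -[[:: x, y, r, s, z3 & r']]/([:: x; y; r; s; z3] ++ r') cat_uniq.
by case/and3P.
Qed.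

End Figures.

(** * Relabelling a matroid along the neighbours of a basis *)

Section Matroid.

Variables (n : nat) (e : rel 'I_n) (E : finType) (Bs : {set {set E}}).
Variable l : 'I_n -> {set E}.
Hypotheses (sym_e : symmetric e) (irr_e : irreflexive e).
Hypotheses (Bs_matroid : is_matroid Bs) (l_iso : exchange_iso e l Bs).

Let d u w := #|l u :\: l w|.
Let md : graph_metric e d := matroid_metric Bs_matroid l_iso.
Let d_sym u w : d u w = d w u := metric_sym sym_e irr_e md u w.
Let inj_l : injective l. Proof. by case: l_iso. Qed.

Lemma exchange_node u w a : a \in l u :\: l w -> exists b x y,
  [/\ b \in l w :\: l u, l x = exchange (l u) a b & l y = exchange (l w) b a].
Proof.
case: l_iso => _ im_l _; case: Bs_matroid => _ exch auw.
have lB z : l z \in Bs by rewrite -im_l imset_f.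
have [b [bwu Bx By]] := exch _ _ (lB u) (lB w) a auw.
have /imsetP[x _ Ex] : exchange (l u) a b \in [set l z | z : 'I_n].
  by rewrite im_l.
have /imsetP[y _ Ey] : exchange (l w) b a \in [set l z | z : 'I_n].
  by rewrite im_l.
by exists b, x, y.
Qed.

(** For a neighbour [w] of [v] these are two singletons, the edge [ab] of the
    fundamental graph of the basis [l v] with [l w = l v - a + b]. Keeping the
    singletons avoids the choice of an element for the other nodes. *)
Definition exchange_pair v w : {set E} * {set E} := (l v :\: l w, l w :\: l v).

Lemma exchange_pairP v w : e v w -> exists a b,
  [/\ exchange_pair v w = ([set a], [set b]), a \in l v, b \notin l v
    & l w = exchange (l v) a b].
Proof.
rewrite (metric_edge irr_e md) => vw; have := vw; rewrite d_sym.
move: vw => /cards1P[a Ea] /cards1P[b Eb]; exists a, b.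
have : a \in l v :\: l w by rewrite Ea set11.
have : b \in l w :\: l v by rewrite Eb set11.
move=> bwv avw; have lw : l w = exchange (l v) a b.
  by apply: exchangeP; rewrite // ?Ea ?Eb cards1.
rewrite /exchange_pair Ea Eb; split=> //.
  by move: avw; rewrite inE => /andP[].
by move: bwv; rewrite inE => /andP[].
Qed.

Lemma exchange_line_rep v : line_rep e [set w | e v w] (exchange_pair v).
Proof.
split=> u w; rewrite !inE => /exchange_pairP[a [b [-> av bv lu]]];
  move=> /exchange_pairP[a' [b' [-> a'v b'v lw]]].
  by case=> /set1_inj aa' /set1_inj bb'; apply: inj_l; rewrite lu lw aa' bb'.
rewrite (metric_edge irr_e md) /d lu lw card_exchange_exchange //.
rewrite /line_adj xpair_eqE /= !(inj_eq set1_inj).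
by case: (a == a'); case: (b == b').
Qed.

Lemma matroid_opposite u w : d u w = 2 -> exists x y,
  [/\ e x u && e x w, e y u && e y w, x != y & ~~ e x y].
Proof.
move=> uw; have /set0Pn[a auw] : l u :\: l w != set0.
  by rewrite -cards_eq0 -/(d u w) uw.
have [b [x [y [bwu lx ly]]]] := exchange_node auw.
have [aw au] : a \notin l w /\ a \in l u by move: auw; rewrite inE => /andP.
have [bu bw] : b \notin l u /\ b \in l w by move: bwu; rewrite inE => /andP.
have uw1 : #|(l u :\: l w) :\ a| = 1.
  by move: uw; rewrite /d (cardsD1 a) auw => -[].
have ux : e u x by rewrite (metric_edge irr_e md) /d lx exchange_setDl ?cards1.
have yw : e y w by rewrite (metric_edge irr_e md) /d ly exchange_setDr ?cards1.
have xw : e x w.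
  rewrite (metric_edge irr_e md) /d lx; apply/eqP; rewrite -uw1.
  apply: eq_card => z; rewrite !inE; have [->|_] := altP (z =P b).
    by rewrite bw ?andbF.
  by case: (z == a); rewrite ?andbF.
have uy : e u y.
  rewrite (metric_edge irr_e md) /d ly; apply/eqP; rewrite -uw1.
  apply: eq_card => z; rewrite !inE; have [->|_] := altP (z =P b).
    by rewrite (negPf bu) ?andbF.
  by case: (z == a); case: (z \in l w); case: (z \in l u).
have ax : a \notin l x.
  by rewrite lx !inE eqxx orbF; apply: contraNneq bu => <-.
have bx : b \in l x by rewrite lx setU11.
have ay : a \in l y by rewrite ly setU11.
have by_ : b \notin l y.
  by rewrite ly !inE eqxx orbF; apply: contraNneq aw => <-.
exists x, y; rewrite !(sym_e _ u) ux xw uy yw; split=> //.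
  by apply: contraNneq ax => ->.
have [inj_f e_f] := exchange_line_rep u.
rewrite e_f ?inE // /line_adj /exchange_pair /=; apply/negP=> /andP[_].
case/orP=> /eqP/setP; last by move/(_ b); rewrite !inE bx bu (negPf by_).
by move/(_ a); rewrite !inE au ay ax.
Qed.

(** Among the neighbours of [u], the common neighbours with [w] are the edges of
    a four-cycle: their endpoints are the two elements of [l u :\: l w] and the
    two elements of [l w :\: l u]. The opposite edges [x] and [y] already use all
    four, so that any other common neighbour mixes their endpoints. *)
Lemma matroid_good_subgraph u w : d u w = 2 ->
  good_neighbour_subgraph e u w [seq x <- enum 'I_n | e x u && e x w].
Proof.
move=> uw; have [x [y [cx cy xy Nxy]]] := matroid_opposite uw.
have Nuw : ~~ e u w by rewrite (metric_edge irr_e md) uw.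
have uw' : u != w by rewrite -(metric0 md) uw.
have fP := exchange_line_rep u; pose f := exchange_pair u.
have inN z : e z u && e z w -> z \in [set z | e u z].
  by case/andP=> zu _; rewrite inE sym_e.
have [exy Nfxy] := line_rep_edge fP (inN x cx) (inN y cy) xy.
move: Nxy (Nxy); rewrite {1}exy negb_or => /andP[Nr Nc] Nxy.
have sub z : e z u && e z w -> (f z).1 \subset l u :\: l w /\
    (f z).2 \subset l w :\: l u.
  case/andP=> zu zw; have [/subsetP s1 /subsetP s2] :=
    between_labels sym_e irr_e md (fun _ _ => erefl) uw zu zw.
  split; apply/subsetP=> a; rewrite !inE => /andP[az au].
    by rewrite au andbT; apply: contra az => aw; apply: s1; rewrite inE au.
  by rewrite az; have := s2 a au; rewrite inE (negPf az).
have single z : e z u && e z w -> exists a b, f z = ([set a], [set b]).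
  by move/inN; rewrite inE => /exchange_pairP[a [b [fz _ _ _]]]; exists a, b.
have [a [b fx]] := single x cx; have [a' [b' fy]] := single y cy.
have two z : e z u && e z w ->
    ((f z).1 = (f x).1 \/ (f z).1 = (f y).1) /\
    ((f z).2 = (f x).2 \/ (f z).2 = (f y).2).
  move=> cz; have [c [c' fz]] := single z cz.
  have pairE (A : {set E}) p q r : [set p] != [set q] -> #|A| = 2 ->
      [set p] \subset A -> [set q] \subset A -> [set r] \subset A ->
      [set r] = [set p] \/ [set r] = [set q].
    rewrite (inj_eq set1_inj) => pq cA; rewrite !sub1set => pA qA.
    have <- : [set p; q] = A.
      apply/eqP; rewrite eqEcard cA cards2 pq andbT; apply/subsetP=> t.
      by case/set2P=> ->.
    by case/set2P=> ->; [left|right].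
  move: Nr Nc; rewrite -/(f x) -/(f y) => Nr Nc.
  have [x1 x2] := sub x cx; have [y1 y2] := sub y cy; have [z1 z2] := sub z cz.
  move: Nr Nc x1 x2 y1 y2 z1 z2; rewrite fx fy fz /= => Nr Nc x1 x2 y1 y2 z1 z2.
  split; first exact: (pairE (l u :\: l w)).
  by apply: (pairE (l w :\: l u)); rewrite // -/(d w u) d_sym.
have inj_f : {in [set z | e u z] &, injective f} := fP.1.
have same z t : e z u && e z w -> e t u && e t w ->
    (f z).1 = (f t).1 -> (f z).2 = (f t).2 -> z = t.
  move=> cz ct E1 E2; apply: inj_f; rewrite ?inN //.
  by rewrite (surjective_pairing (f z)) E1 E2 -surjective_pairing.
have mixed z : e z u && e z w -> z != x -> z != y ->
    (f z).1 = (f x).1 /\ (f z).2 = (f y).2 \/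
    (f z).1 = (f y).1 /\ (f z).2 = (f x).2.
  move=> cz zx zy; have [[r|r] [c|c]] := two z cz.
  - by rewrite (same z x) ?eqxx in zx.
  - by left.
  - by right.
  by rewrite (same z y) ?eqxx in zy.
apply: (opposite_good_subgraph sym_e irr_e uw' Nuw cx cy xy Nxy).
- move=> z cz zx zy; rewrite eq_sym in zx; rewrite eq_sym in zy.
  rewrite (line_rep_edge fP (inN x cx) (inN z cz) zx).
  rewrite (line_rep_edge fP (inN y cy) (inN z cz) zy) -/(f _) -/(f _) -/(f _).
  rewrite eq_sym in zx; rewrite eq_sym in zy.
  by case: (mixed z cz zx zy) => -[-> ->]; rewrite !eqxx ?orbT.
- move=> z t cz zx zy ct tx ty zt.
  rewrite (line_rep_edge fP (inN z cz) (inN t ct) zt) -/(f z) -/(f t).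
  case: (mixed z cz zx zy) (mixed t ct tx ty) => -[z1 z2] [] -[t1 t2].
  - by rewrite (same z t) ?z1 ?z2 ?t1 ?t2 ?eqxx in zt.
  - by rewrite z1 z2 t1 t2 negb_or (eq_sym (f y).2) Nr.
  - by rewrite z1 z2 t1 t2 negb_or (eq_sym (f y).1) Nr.
  by rewrite (same z t) ?z1 ?z2 ?t1 ?t2 ?eqxx in zt.
move=> z1 z2 z3 c1 c2 c3; apply/negP; rewrite /= !inE !negb_or.
case/and5P=> /and4P[_ x1 x2 x3] /and3P[y1 y2 y3] /andP[z12 z13] z23 _.
rewrite eq_sym in x1; rewrite eq_sym in x2; rewrite eq_sym in x3.
rewrite eq_sym in y1; rewrite eq_sym in y2; rewrite eq_sym in y3.
case: (mixed z1 c1 x1 y1) (mixed z2 c2 x2 y2) (mixed z3 c3 x3 y3)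
  => -[r1 k1] [] -[r2 k2] [] -[r3 k3];
 first [ by rewrite (same z1 z2) ?r1 ?k1 ?r2 ?k2 ?eqxx in z12
       | by rewrite (same z1 z3) ?r1 ?k1 ?r3 ?k3 ?eqxx in z13
       | by rewrite (same z2 z3) ?r2 ?k2 ?r3 ?k3 ?eqxx in z23 ].
Qed.

(** A union [S] of components of the fundamental graph of [l v] meets all bases
    equally often: a symmetric exchange between [l v] and [l u] stays inside or
    outside of [S], because it is an edge of the fundamental graph, and it brings
    [l u] closer to [l v]. *)
Lemma card_exchange_closed v (S : {set E}) :
    (forall w a b, e v w -> a \in l v :\: l w -> b \in l w :\: l v ->
       (a \in S) = (b \in S)) ->
  forall u, #|l u :&: S| = #|l v :&: S|.
Proof.
move=> closed u; have [k le_k] : exists k, #|l v :\: l u| <= k.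
  by exists #|l v :\: l u|.
elim: k u le_k => [|k IHk] u.
  by rewrite leqn0 -/(d v u) (metric0 md) => /eqP->.
have [/eqP|[a avu] le_k] := set_0Vmem (l v :\: l u).
  by rewrite -cards_eq0 -/(d v u) (metric0 md) => /eqP->.
have [b [x [y [buv lx ly]]]] := exchange_node avu.
have [au av] : a \notin l u /\ a \in l v by move: avu; rewrite inE => /andP.
have [bv bu] : b \notin l v /\ b \in l u by move: buv; rewrite inE => /andP.
have ab : (a \in S) = (b \in S).
  apply: (closed x); last by rewrite lx exchange_setDr ?set11.
    by rewrite (metric_edge irr_e md) /d lx exchange_setDl ?cards1.
  by rewrite lx exchange_setDl ?set11.
rewrite -(IHk y); last first.
  rewrite -ltnS; apply: leq_trans le_k.
  rewrite [X in _ < X](cardsD1 a) avu ltnS.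
  apply/subset_leq_card/subsetP=> z; rewrite ly !inE; case: (z == a) => //=.
  by have [->|_] := altP (z =P b); rewrite ?(negPf bv) ?andbF.
rewrite (cardsD1 b) [RHS](cardsD1 a) ly !inE eqxx bu /= ab; congr (_ + _).
apply: eq_card => z; rewrite !inE; have [->|_] := altP (z =P a) => //=.
  by rewrite (negPf au) andbF.
by rewrite andbA.
Qed.

Section Relabel.

Variables (X Y : finType) (v : 'I_n) (phi : 'I_n -> X * Y).
Let N : {set 'I_n} := [set w | e v w].
Hypothesis phiP : line_rep e N phi.

Let f := exchange_pair v.
Let fP : line_rep e N f := exchange_line_rep v.
Let flipped := flip e N f phi.

Let end_of x : {set E} + {set E} :=
  if x \in l v then inl [set x] else inr [set x].

Let end_of_inj : injective end_of.
Proof.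
by move=> x y; rewrite /end_of; do 2!case: ifP => _; case=> // /set1_inj.
Qed.

Let flip_endpoint s s' w z : w \in N -> z \in N ->
  endpoint s (f w) = endpoint s' (f z) -> flipped w = flipped z.
Proof.
move=> wN zN /eqP; have [->//|wz] := altP (w =P z); rewrite endpoint_eq => pE.
apply: (flip_edge sym_e irr_e fP phiP) => //.
rewrite (line_rep_edge fP wN zN wz).
by case: s pE => /andP[_ ->]; rewrite ?orbT.
Qed.

Let endP s w : w \in N -> exists x,
  [/\ endpoint s (f w) = end_of x, (x \in l v) = s & (x \in l w) = ~~ s].
Proof.
rewrite inE => /exchange_pairP[a [b [fE av bv lw]]].
exists (if s then a else b); rewrite /f fE /end_of lw; case: s.
  rewrite av !inE eqxx orbF; split=> //.
  by apply: contraNF bv => /eqP<-.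
by rewrite (negPf bv) !inE eqxx.
Qed.

Let is_end (x : E) (ws : 'I_n * bool) : bool :=
  (ws.1 \in N) && (endpoint ws.2 (f ws.1) == end_of x).

(** The correspondence of endpoints in [line_rep_unique] as a map on elements,
    injective on the set [ends] of the elements in question. *)
Let relabel (x : E) : X + Y :=
  if [pick ws | is_end x ws] is Some ws
  then endpoint (ws.2 (+) flipped ws.1) (phi ws.1)
  else inl (phi v).1.

Let relabelE w s x : w \in N -> endpoint s (f w) = end_of x ->
  relabel x = endpoint (s (+) flipped w) (phi w).
Proof.
move=> wN fx; rewrite /relabel.
case: pickP => [[w' s'] /= /andP[w'N /eqP f'x]|].
  by apply/eqP; rewrite -(line_rep_unique sym_e irr_e fP phiP) // -/f /= f'x fx.
by move/(_ (w, s)); rewrite /is_end /= wN fx eqxx.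
Qed.

Let ends : {set E} := [set x | [exists ws, is_end x ws]].
Let S : {set E} := [set x | [exists ws, is_end x ws && flipped ws.1]].

Let mem_ends w s x : w \in N -> endpoint s (f w) = end_of x -> x \in ends.
Proof.
move=> wN fx; rewrite inE; apply/existsP; exists (w, s).
by rewrite /is_end /= wN fx eqxx.
Qed.

Let memS w s x : w \in N -> endpoint s (f w) = end_of x ->
  (x \in S) = flipped w.
Proof.
move=> wN fx; rewrite inE; apply/existsP/idP =>
  [[[w' s'] /= /andP[/andP[/= w'N /eqP f'x]]]|flw].
  by rewrite (flip_endpoint w'N wN (etrans f'x (esym fx))).
by exists (w, s); rewrite /is_end /= wN fx eqxx.
Qed.

Let relabel_inj : {in ends &, injective relabel}.
Proof.
move=> x y; rewrite !inE => /existsP[[w s] /andP[/= wN /eqP wx]].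
move=> /existsP[[z t] /andP[/= zN /eqP zy]].
rewrite (relabelE wN wx) (relabelE zN zy) => /eqP.
rewrite -(line_rep_unique sym_e irr_e fP phiP) // -/f wx zy.
by move/eqP/end_of_inj.
Qed.

(** The symmetric difference with [S] complements each basis inside the flipped
    components. The elements outside of [ends] are loops and coloops; they have no
    counterpart among the endpoints of [phi]. *)
Let moved u : {set E} := ends :&: ((l u :\: S) :|: (S :\: l u)).

Let new_label u : {set X + Y} := relabel @: moved u.

Let mem_new u x : x \in ends ->
  (relabel x \in new_label u) = (x \in l u) (+) (x \in S).
Proof.
move=> xE; apply/imsetP/idP => [[y]|xu].
  rewrite inE => /andP[yE]; rewrite !inE => yu /relabel_inj -> //.
  by move: yu; case: (y \in l u); case: [exists _, _].
exists x; rewrite // !inE; move: xE xu; rewrite !inE => ->.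
by case: (x \in l u); case: [exists _, _].
Qed.

Let closedS w a b : e v w -> a \in l v :\: l w -> b \in l w :\: l v ->
  exists2 w', w' \in N &
    endpoint true (f w') = end_of a /\ endpoint false (f w') = end_of b.
Proof.
move=> vw avw bwv; exists w; first by rewrite inE.
have [a' [b' [fE _ _ _]]] := exchange_pairP vw; rewrite /f fE /end_of.
move: (avw) (bwv) fE; rewrite !inE => /andP[_ ->] /andP[/negPf-> _].
rewrite /exchange_pair => -[Ea Eb]; move: avw bwv; rewrite Ea Eb !inE.
by move=> /eqP-> /eqP->.
Qed.

Let card_S u w : #|l u :&: S| = #|l w :&: S|.
Proof.
have H z : #|l z :&: S| = #|l v :&: S|; last by rewrite !H.
apply: card_exchange_closed => {}w a b vw avw bwv.
have [w' w'N [fa fb]] := closedS vw avw bwv.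
by rewrite (memS w'N fa) (memS w'N fb).
Qed.

Let notin_ends u w x : x \notin ends -> (x \in l u) = (x \in l w).
Proof.
move=> xE; have H z : #|l z :&: [set x]| = #|l v :&: [set x]|.
  apply: card_exchange_closed => {}w a b vw avw bwv.
  have [w' w'N [fa fb]] := closedS vw avw bwv; rewrite !inE.
  have /negPf-> : a != x by apply: contraNneq xE => <-; apply: mem_ends fa.
  by apply/esym/negbTE; apply: contraNneq xE => <-; apply: mem_ends fb.
have cE z : (x \in l z) = (#|l z :&: [set x]| == 1).
  have [xz|xz] := boolP (x \in l z).
    by rewrite (setIidPr _) ?cards1 ?sub1set.
  apply/esym; suff -> : l z :&: [set x] = set0 by rewrite cards0.
  apply/setP=> y; rewrite !inE.
  by case: eqP => [->|]; rewrite ?(negPf xz) ?andbF.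
by rewrite !cE !H.
Qed.

Let card_new u w : #|new_label u :\: new_label w| = #|l u :\: l w|.
Proof.
have sub_moved z : {subset moved z <= ends} by move=> x; rewrite inE => /andP[].
have injE z : {in moved z &, injective relabel}.
  by move=> x y /sub_moved xE /sub_moved yE; apply: relabel_inj.
rewrite cardsD -imsetI; last first.
  by move=> x y /sub_moved xE /sub_moved yE; apply: relabel_inj.
rewrite !card_in_imset -?cardsD //; last first.
  by move=> x y /setIP[xu _] /setIP[yu _]; apply: (injE u).
have -> : moved u :\: moved w = ((l u :\: l w) :\: S) :|: ((l w :\: l u) :&: S).
  apply/setP=> x; have [xE|xE] := boolP (x \in ends); last first.
    rewrite !(in_setD, in_setI, in_setU) (negPf xE) (notin_ends u w xE) /=.
    by case: (x \in l w); case: (x \in S).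
  rewrite !(in_setD, in_setI, in_setU) xE /=.
  by case: (x \in l u); case: (x \in l w); case: (x \in S).
have disj A B : (A :\: S) :&: (B :&: S) = set0.
  by apply/setP=> x; rewrite !inE; case: [exists _, _]; rewrite ?andbF.
rewrite cardsU disj cards0 subn0 -[RHS](cardsID S) addnC; congr (_ + _).
have part A B : #|A :&: S| = #|A :&: B :&: S| + #|(A :\: B) :&: S|.
  by rewrite -(cardsID B (A :&: S)) setIAC setIDAC.
have := card_S u w; rewrite (part (l u) (l w)) (part (l w) (l u)) (setIC (l w)).
by move/addnI.
Qed.

(** The answer [phi] of the root routine can be extended to an isometric
    labelling, although it need not come from the given matroid. *)
Theorem line_rep_labelling : exists l1 : 'I_n -> {set X + Y},
  [/\ forall u w, #|l1 u :\: l1 w| = #|l u :\: l w|,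
      l1 v = [set inl (phi w).1 | w in N]
    & {in N, forall w, l1 w = inr (phi w).2 |: (l1 v :\ inl (phi w).1)}].
Proof.
exists new_label; split=> [u w||w wN]; first exact: card_new.
  apply/setP=> t; apply/idP/imsetP => [/imsetP[x]|[w wN ->]].
    rewrite !inE => /andP[/existsP[[w s] /andP[/= wN /eqP wx]]] xv ->.
    exists w => //; rewrite (relabelE wN wx).
    have sE : (x \in l v) = s.
      by move: wx; rewrite /end_of; case: (x \in l v); case: (s).
    have := memS wN wx; rewrite inE => flE; move: xv; rewrite flE sE.
    by case: (s); case: (flipped w).
  (* the element of [l v - l w], or of [l w - l v] if the edge is flipped *)
  have [x [wx xv _]] := endP (~~ flipped w) wN.
  have <- : relabel x = inl (phi w).1 by rewrite (relabelE wN wx) addNb addbb.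
  by rewrite mem_new ?(mem_ends wN wx) // xv (memS wN wx) addNb addbb.
have [vw wv] : #|l v :\: l w| = 1 /\ #|l w :\: l v| = 1.
  have : e v w by rewrite inE in wN.
  rewrite (metric_edge irr_e md) => /eqP vw.
  by rewrite -/(d v w) -/(d w v) (d_sym w).
apply: exchangeP; rewrite ?card_new //.
  have [x [wx xv xw]] := endP (~~ flipped w) wN.
  have <- : relabel x = inl (phi w).1 by rewrite (relabelE wN wx) addNb addbb.
  rewrite inE !mem_new ?(mem_ends wN wx) // xv xw (memS wN wx).
  by case: (flipped w).
have [x [wx xv xw]] := endP (flipped w) wN.
have <- : relabel x = inr (phi w).2 by rewrite (relabelE wN wx) addbb.
rewrite inE !mem_new ?(mem_ends wN wx) // xv xw (memS wN wx).
by case: (flipped w).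
Qed.

End Relabel.

End Matroid.

(** * The labelling algorithm *)

Lemma sum_size_levels (T : Type) (f : T -> nat) (s : seq T) (r : seq nat) :
  uniq r -> \sum_(j <- r) size [seq u <- s | f u == j] <= size s.
Proof.
move=> ur; elim: s => [|u s IHs] /=; first by rewrite big1.
rewrite (eq_bigr (fun j => (f u == j) + size [seq u <- s | f u == j])).
  rewrite big_split /= -add1n leq_add //.
  have [fur|fur] := boolP (f u \in r); last first.
    rewrite big1_seq // => j /andP[_ jr].
    by case: eqP => // fuj; rewrite fuj jr in fur.
  rewrite (bigD1_seq (f u)) //= eqxx big1 ?addn0 // => j.
  by rewrite eq_sym => /negPf->.
by move=> j _; case: (f u == j).
Qed.

Section Algorithm.

Variables (n : nat) (e : rel 'I_n).
Hypotheses (sym_e : symmetric e) (irr_e : irreflexive e).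

Lemma basis_graph_line_graph v :
  basis_exchange_graph e ->
  line_graph_of_bipartite e [seq w <- enum 'I_n | e v w].
Proof.
move=> [E [Bs [l [Bs_matroid l_iso]]]].
have [inj_f e_f] := exchange_line_rep sym_e irr_e Bs_matroid l_iso v.
pose f := exchange_pair l v; set H := filter _ _.
have inH w : w \in H -> w \in [set w | e v w].
  by rewrite mem_filter inE => /andP[].
exists {set E}, {set E}, [set f w | w in H], f.
by split=> // u w /inH uH /inH wH; [apply: inj_f | apply: e_f].
Qed.

Variable d : 'I_n -> 'I_n -> nat.
Hypothesis md : graph_metric e d.

(** If there is such a labelling, it is the only one that the algorithm can
    compute from [phi]. *)
Definition model_labelling v (phi : 'I_n -> 'I_n * 'I_n)
    (l : 'I_n -> {set elt n}) : Prop :=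
  [/\ forall u w, #|l u :\: l w| = d u w,
      l v = [set inl (phi w).1 | w in [set w | e v w]]
    & {in [set w | e v w], forall w,
        l w = inr (phi w).2 |: (l v :\ inl (phi w).1)}].

Lemma basis_graph_model v phi :
    line_rep e [set w | e v w] phi -> basis_exchange_graph e ->
  exists l, model_labelling v phi l.
Proof.
move=> phiP [E [Bs [l [Bs_matroid l_iso]]]].
have [l1 [iso_l1 l1v l1w]] :=
  line_rep_labelling sym_e irr_e Bs_matroid l_iso phiP.
exists l1; split=> // u w; rewrite iso_l1.
exact: (graph_metric_uniq (matroid_metric Bs_matroid l_iso) md).
Qed.

Lemma basis_graph_figures u w : basis_exchange_graph e -> d u w = 2 ->
  good_neighbour_subgraph e u w [seq x <- enum 'I_n | e x u && e x w] /\
  exists x y, [/\ e x u && e x w, e y u && e y w, x != y & ~~ e x y].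
Proof.
move=> [E [Bs [l [Bs_matroid l_iso]]]].
rewrite -(graph_metric_uniq (matroid_metric Bs_matroid l_iso) md) => uw.
split; first exact: (matroid_good_subgraph sym_e irr_e Bs_matroid l_iso).
exact: (matroid_opposite sym_e irr_e Bs_matroid l_iso).
Qed.

End Algorithm.

(** The invariants of the labelling loops are relative to an arbitrary model
    labelling. If the graph is a basis exchange graph then there is one, and a
    rejection would contradict it; so a rejection is always justified. For an
    acceptance only the final loop matters. *)
Lemma algorithm1_spec n (e : rel 'I_n) root c :
    1 < n -> symmetric e -> irreflexive e -> (forall u v, connect e u v) ->
    (forall H, uniq H -> spec c (~ line_graph_of_bipartite e H)
       (fun phi => exists K : {set 'I_n * 'I_n}, line_iso e H K phi)
       (root H)) ->
  spec (c + 60 * n ^ 3) (~ basis_exchange_graph e)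
    (fun l => valid_labelling e l) (algorithm1 e root).
Proof.
move=> n1 sym_e irr_e conn_e root_spec; have n0 : 0 < n := ltnW n1.
set R := ~ _.
(* [cb] bounds the cost of labelling one node, and the summands of [total]
   follow the program text; the last but two stands for all levels together *)
pose cb := n + (1 + (n + (n * n + (1 + (n + n + 0))))).
pose total := n * n + n * (n * n).+1 + (1 + (n + (c + (n + n + (n * 1 +
  (n * (n + n) + (n + n + (n * (n + n + 0).+1 + (n + n +
  (n * n.+1 + n * (1 + (n + cb)) + (n * n * (n + n + (n + 0)).+1 + 0))))))))))).
apply: (spec_le (c := total)).
  by rewrite /total /cb; case: (n) n0 => // k _; rewrite !expnS; nia.
rewrite /total /algorithm1.
have s_elts : size (enum {: elt n}) = n + n.
  by rewrite -cardE card_sum card_ord.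
apply: (spec_bind (@distances_spec _ _ R conn_e)) => d md.
apply: spec_bind_pick => [|v _]; first by rewrite -size_eq0 size_enum_ord -lt0n.
have sV (p : pred 'I_n) : size (filter p (enum 'I_n)) <= n.
  by rewrite size_filter (leq_trans (count_size _ _)) ?size_enum_ord.
apply: spec_bind_pass; first by rewrite size_enum_ord.
set H := filter _ _; have inH w : (w \in H) = e v w.
  by rewrite mem_filter mem_enum andbT.
have uH : uniq H by rewrite filter_uniq ?enum_uniq.
apply: (spec_bind (M := line_rep e [set w | e v w])) => [|phi phiP].
  apply: spec_weaken (root_spec H uH) (leqnn _) _ _.
    by move=> NLG /(basis_graph_line_graph sym_e irr_e v).
  move=> phi [K [inj_phi _ e_phi]].
  by split=> u w; rewrite !inE -!inH; [apply: inj_phi | apply: e_phi].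
apply: spec_bind_pass; first by rewrite s_elts.
pose N := [set w | e v w].
apply: (spec_bind_foldP (Inv := fun pre (B : {set elt n}) =>
  forall t, (t \in B) = (t \in [seq inl (phi w).1 | w <- pre]))).
- exact: sV.
- by move=> t; rewrite inE.
- move=> pre w post B _ EB; apply: spec_ret => t.
  by rewrite map_rcons mem_rcons !inE EB.
move=> B1 EB1; have {}EB1 : B1 = [set inl (phi w).1 | w in N].
  apply/setP=> t; rewrite EB1; apply/mapP/imsetP => -[w wH ->]; exists w => //.
    by rewrite inE -inH.
  by rewrite inH; rewrite inE in wH.
apply: spec_bind_pass; first by rewrite size_allpairs size_enum_ord s_elts.
apply: spec_bind_pass; first by rewrite s_elts.
pose first_labels (l : 'I_n -> {set elt n}) (pre : seq 'I_n) := l v = B1 /\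
  {in pre, forall w, l w = inr (phi w).2 |: (B1 :\ inl (phi w).1)}.
apply: (spec_bind_foldP (Inv := fun pre l => first_labels l pre)).
- exact: sV.
- by split=> //; rewrite /set_at eqxx.
- move=> pre w post l EH [lv lw].
  apply: spec_bind_pass; first by rewrite s_elts.
  apply: spec_ret; split.
    have: w \in H by rewrite EH mem_cat mem_head orbT.
    by rewrite inH /set_at; case: eqP => // ->; rewrite irr_e.
  move=> z; rewrite mem_rcons inE /set_at; case: eqP => [-> //|_] /=.
  exact: lw.
move=> l1 [l1v l1H].
apply: spec_bind_pass; first by rewrite s_elts.
set m := #|B1|.
have mn : m <= n.
  rewrite /m EB1 (leq_trans (leq_imset_card _ _)) //.
  by rewrite -[leqRHS]card_ord max_card.
pose model := model_labelling e d v phi.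
pose labelled k (l : 'I_n -> {set elt n}) :=
  forall l', model l' -> forall u, d u v < k -> l u = l' u.
pose level j := [seq u <- enum 'I_n | d u v == j].
apply: (spec_bind (M := labelled (2 + size (iota 2 m.-1)))).
  apply: (spec_le (c := \sum_(j <- iota 2 m.-1)
      (n + size (level j) * (1 + (n + cb))).+1)).
    rewrite (eq_bigr (fun j => n.+1 + size (level j) * (1 + (n + cb))))
      => [|j _].
      rewrite big_split /= -big_distrl /= big_const_seq count_predT iter_addn_0.
      rewrite size_iota mulnC leq_add ?leq_mul2r ?orbT //.
        by rewrite (leq_trans (leq_pred m)) // orbT.
      have := sum_size_levels (fun u => d u v) (enum 'I_n) (iota_uniq 2 m.-1).
      by rewrite size_enum_ord => ->; rewrite orbT.
    by rewrite addSn.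
  apply: (spec_foldP (Inv := fun pre l => labelled (2 + size pre) l)).
    move=> l' [_ l'v l'w] u; rewrite ltnS leq_eqVlt ltnS leqn0 (metric0 md).
    rewrite -/N -EB1 in l'v; case/orP=> [|/eqP->]; last by rewrite l1v.
    rewrite (metric_sym sym_e irr_e md) -(metric_edge irr_e md) => vu.
    by rewrite l1H ?inH // l'w ?inE // l'v.
  move=> pre j post l Epre inv.
  have Ej : j = 2 + size pre.
    have := congr1 (fun s => nth 0 s (size pre)) Epre.
    rewrite nth_cat ltnn subnn /= nth_iota //.
    by rewrite -(size_iota 2 m.-1) Epre size_cat /= -addSnnS leq_addr.
  apply: spec_bind_pass; first by rewrite size_enum_ord.
  rewrite -/(level j); pose level_inv (L : seq 'I_n) l := labelled j l /\
    forall l', model l' -> forall u, d u v = j -> u \notin L -> l u = l' u.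
  apply: (spec_weaken (P := level_inv [::])); first 1 last.
  - exact: leqnn.
  - exact: id.
  - move=> l' [l'_lt l'_j] l0 l0P u.
    rewrite size_rcons addnS -Ej ltnS leq_eqVlt.
    by case/orP=> [/eqP uj|uj]; [apply: l'_j | apply: l'_lt].
  apply: (spec_drain (Inv := level_inv)); first exact: sV.
    split=> [|l' _ u uj]; first by rewrite Ej.
    by rewrite mem_filter mem_enum uj eqxx.
  move=> L u l' uL sub_L [l'_lt l'_j].
  have uj : d u v = j by have := sub_L u uL; rewrite mem_filter => /andP[/eqP].
  have j1 : 1 < j by rewrite Ej.
  rewrite /cb; apply: spec_bind_pass; first by rewrite size_enum_ord.
  apply: spec_bind_pick => [|v'].
    have [x xv xu] := metric_back2 sym_e irr_e md uj j1.
    have : x \in [seq x <- enum 'I_n | (d x v == j - 2) && (d x u == 2)].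
      by rewrite mem_filter mem_enum xv xu !eqxx.
    by case: filter.
  rewrite mem_filter => /andP[/andP[/eqP v'v /eqP v'u] _].
  apply: spec_bind_pass; first by rewrite size_enum_ord.
  set T := filter _ _.
  have inT w : (w \in T) = e w u && e w v'.
    by rewrite mem_filter mem_enum andbT !(metric_edge irr_e md).
  apply: spec_bind_pass; first by rewrite size_allpairs leq_mul ?sV.
  set W := filter _ _.
  have inW w : (w \in W) = [&& w.1 != w.2, ~~ e w.1 w.2, w.1 \in T & w.2 \in T].
    case: w => w1 w2; rewrite mem_filter -andbA; congr [&& _, _ & _].
    apply/allpairsP/andP => [[[x y] [xT yT [-> ->]]] //|[w1T w2T]].
    by exists (w1, w2).
  have uv' : d u v' = 2 by rewrite (metric_sym sym_e irr_e md).
  have WN0 : basis_exchange_graph e -> W != [::].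
    move=> BG; have [_ [x [y [cx cy xy Nxy]]]] :=
      basis_graph_figures sym_e irr_e md BG uv'.
    have : (x, y) \in W by rewrite inW /= xy Nxy !inT cx cy.
    by case: (W).
  case: W inW WN0 => [_ N0|w0 W inW _]; first by apply: spec_reject => /N0.
  apply: spec_bind_pick => // -[x y]; rewrite inW !inT /=.
  case/and4P=> xy Nxy /andP[xu xv'] /andP[yu yv'].
  apply: spec_bind_pass; first by rewrite s_elts.
  have near z : e z v' -> d z v < j.
    rewrite (metric_edge irr_e md) => /eqP zv'.
    by have := metric_triangle md z v' v; rewrite zv' v'v; lia.
  apply: spec_ret; split=> l0 l0P z zj.
    rewrite /set_at; case: eqP => [zu|_]; last exact: l'_lt.
    by rewrite zu uj ltnn in zj.
  rewrite /set_at; case: eqP => [->|/eqP zu] zL.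
    have [iso_l0 _ _] := l0P.
    rewrite (square_labels sym_e irr_e md iso_l0 uv' xu xv' yu yv' xy Nxy).
    have v'j : d v' v < j by rewrite v'v; lia.
    by rewrite !(l'_lt l0) // near.
  by apply: l'_j => //; apply: contra zL => zL; apply: rem_mem.
move=> l2; rewrite size_iota => l2P.
(* the loop ends at [m = #|l' v|], which bounds all distances to [v] *)
have l2E l' : model l' -> l2 =1 l'.
  move=> l'P u; apply: (l2P) => //; have [iso_l' l'v _] := l'P.
  rewrite (metric_sym sym_e irr_e md) -iso_l'.
  have : #|l' v :\: l' u| <= m.
    by rewrite /m EB1 -l'v subset_leq_card // subsetDl.
  by case: (m) => [|k] /=; lia.
apply: (spec_bind_foldP (Inv := fun pre _ => forall u w, (u, w) \in pre ->
  #|l2 u :\: l2 w| = d u w /\ (d u w = 2 ->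
  good_neighbour_subgraph e u w [seq x <- enum 'I_n | e x u && e x w]))).
- by rewrite size_allpairs size_enum_ord.
- by [].
- move=> pre [u w] post _ _ inv; apply: spec_bind_pass; first by rewrite s_elts.
  have [kd|kd] := boolP (_ != _).
    apply: spec_reject => BG.
    have [l' l'P] := basis_graph_model sym_e irr_e md phiP BG.
    by have [iso_l' _ _] := l'P; rewrite !(l2E l') // iso_l' eqxx in kd.
  have keep : (d u w = 2 ->
      good_neighbour_subgraph e u w [seq x <- enum 'I_n | e x u && e x w]) ->
      forall u' w', (u', w') \in rcons pre (u, w) ->
    #|l2 u' :\: l2 w'| = d u' w' /\ (d u' w' = 2 ->
      good_neighbour_subgraph e u' w' [seq x <- enum 'I_n | e x u' && e x w']).
    move=> good u' w'; rewrite mem_rcons inE => /orP[/eqP[-> ->]|/inv//].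
    by split=> //; apply/eqP/negPn.
  case: eqP => [d2|d2]; last by apply: spec_ret; apply: keep.
  apply: spec_bind_pass; first by rewrite size_enum_ord.
  case: ifP => good; first by apply: spec_ret; apply: keep.
  apply: spec_reject => BG.
  by have [] := basis_graph_figures sym_e irr_e md BG d2; rewrite good.
move=> _ l2_valid; apply: spec_ret.
apply: (isometric_valid sym_e irr_e md) => // [u w|u w uw].
  by have [] := l2_valid u w (allpairs_f _ (mem_enum _ u) (mem_enum _ w)).
have uwV := allpairs_f pair (mem_enum 'I_n u) (mem_enum 'I_n w).
have [_ /(_ uw) good] := l2_valid u w uwV.
apply: good_subgraph_opposite good => //; first by rewrite -(metric0 md) uw.
by rewrite (metric_edge irr_e md) uw.
Qed.

Theorem proposition14 :
  root_routine original_graph /\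
  forall root : forall n, rel 'I_n -> seq 'I_n -> prog ('I_n -> 'I_n * 'I_n),
    root_routine root ->
    exists C : nat, forall (n : nat) (e : rel 'I_n),
      1 < n -> symmetric e -> irreflexive e -> (forall u v, connect e u v) ->
      every_run (algorithm1 e (root n e)) (fun out t =>
        [/\ isSome out <-> basis_exchange_graph e,
            forall l, out = Some l -> valid_labelling e l
          & t <= C * n ^ 3]).
Proof.
split=> [|root [C rootP]].
  exists 20 => n e H _ sym_e irr_e uH.
  apply: every_run_mono (original_graph_spec sym_e irr_e uH).
  by case=> [phi|] t [].
exists (C + 60) => n e n1 sym_e irr_e conn_e.
have sp := algorithm1_spec (c := C * n ^ 3) (root := root n e)
  n1 sym_e irr_e conn_e.
apply: every_run_mono (sp _) => [[l|] t [t_le]|H uH].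
- move=> l_valid; split; [split=> // _|by move=> _ [<-]|by rewrite mulnDl].
  by have [Bs [Bs_matroid l_iso]] := l_valid; exists (elt n), Bs, l.
- by move=> NBG; split; [split=> // /NBG| |rewrite mulnDl].
apply: every_run_mono (rootP n e H n1 sym_e irr_e uH).
by case=> [phi|] t [].
Qed.
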